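(* Let $(X,g)$ be a multi-Eguchi--Hanson space ($m=0$) or a multi-Taub--NUT space ($m>0$) with exactly two singular points $p_1\neq p_2$ of $\phi$. Then every compact minimal submanifold of $(X,g)$ is $S^1$-invariant or is contained in the unique $S^1$-invariant compact minimal surface of $X$.
   Context: Multi-Eguchi--Hanson and multi-Taub--NUT spaces: let $p_1,\dots,p_k$ be distinct points of $\mathbb{R}^3$ ($k\ge 1$), let $m\ge 0$, let $U=\mathbb{R}^3\setminus\{p_1,\dots,p_k\}$, and let $\phi(x)=m+\sum_{i=1}^k \frac{1}{2|x-p_i|}$ on $U$. Let $\pi:X_0\to U$ be the principal $S^1$-bundle (with $S^1=\mathbb{R}/2\pi\mathbb{Z}$) carrying a connection $1$-form $\eta$ (that is, $\eta$ is $S^1$-invariant and $\eta(\xi)=1$, with $\xi$ the infinitesimal generator of the action) such that $d\eta=\pi^*( *_{\mathbb{R}^3}d\phi)$, and put $g=\phi^{-1}\eta^2+\phi\,\pi^*g_{\mathbb{R}^3}$. Adding one point over each $p_i$ yields a smooth complete hyperkähler $4$-manifold $(X,g)$ to which the $S^1$-action extends (fixing the added points), and $\pi$ extends to $\pi:X\to\mathbb{R}^3$. It is called a multi-Eguchi--Hanson space if $m=0$ and a multi-Taub--NUT space if $m>0$; the $p_i$ are called the singular points of $\phi$. Submanifolds are without boundary and have dimension between $1$ and $3$; minimal means vanishing mean curvature vector. When $k=2$, the unique $S^1$-invariant compact minimal surface is $\pi^{-1}([p_1,p_2])$, where $[p_1,p_2]$ is the straight segment joining $p_1$ and $p_2$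 (it is a sphere). *)

(* Defs.v *)
From mathcomp Require Import all_boot all_order all_algebra.
From mathcomp Require Import all_classical all_reals all_analysis.

Set Implicit Arguments.
Unset Strict Implicit.
Unset Printing Implicit Defensive.

Import Order.TTheory GRing.Theory Num.Theory.
Import numFieldNormedType.Exports.

Local Open Scope classical_set_scope.
Local Open Scope ring_scope.

(* MathComp-Analysis.  C^oo on the open set A: all iterated directional
   derivatives are Frechet differentiable at every point of A. *)
Definition smooth_on (R : realType) (V W : normedModType R)
    (A : set V) (f : V -> W) : Prop :=
  forall (vs : seq V) (x : V), A x ->
    differentiable (foldr (fun v (h : V -> W) => 'D_v h) f vs) x.

(** * Smooth manifolds *)

(* A chart is a homeomorphism between open sets cdom and ccod, given by total
   functions cmap and cinv whose values outside cdom and ccod are irrelevant. *)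
Record chart (R : realType) (T : topologicalType) (n : nat) := Chart {
  cdom : set T;
  ccod : set 'rV[R]_n;
  cmap : T -> 'rV[R]_n;
  cinv : 'rV[R]_n -> T
}.

Definition is_chart (R : realType) (T : topologicalType) (n : nat)
    (c : chart R T n) : Prop :=
  [/\ open (cdom c) /\ open (ccod c),
      forall q, cdom c q -> ccod c (cmap c q) /\ cinv c (cmap c q) = q,
      forall x, ccod c x -> cdom c (cinv c x) /\ cmap c (cinv c x) = x,
      forall q, cdom c q -> {for q, continuous (cmap c)} &
      forall x, ccod c x -> {for x, continuous (cinv c)}].

Definition coord_dom (R : realType) (T T' : topologicalType) (n n' : nat)
    (f : T -> T') (c : chart R T n) (c' : chart R T' n') : set 'rV[R]_n :=
  [set x | ccod c x /\ cdom c' (f (cinv c x))].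

Definition coord (R : realType) (T T' : topologicalType) (n n' : nat)
    (f : T -> T') (c : chart R T n) (c' : chart R T' n') :
    'rV[R]_n -> 'rV[R]_n' :=
  fun x => cmap c' (f (cinv c x)).

Definition compatible (R : realType) (T : topologicalType) (n : nat)
    (c c' : chart R T n) : Prop :=
  smooth_on (coord_dom id c c') (coord id c c') /\
  smooth_on (coord_dom id c' c) (coord id c' c).

(* The atlas is maximal, so that "c is in the atlas" means "c is a smooth
   chart"; charts take values in open subsets of R^n, so there is no boundary. *)
Record manifold (R : realType) (n : nat) := Manifold {
  mcarrier :> topologicalType;
  atlas : set (chart R mcarrier n);
  mhausdorff : hausdorff_space mcarrier;
  msecond_countable : @second_countable mcarrier;
  atlas_chart : forall c, atlas c -> is_chart c;
  atlas_cover : forall q, exists2 c, atlas c & cdom c q;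
  atlas_compatible : forall c c', atlas c -> atlas c' -> compatible c c';
  atlas_maximal : forall c, is_chart c ->
    (forall c', atlas c' -> compatible c c') -> atlas c
}.

Definition smooth_map (R : realType) (n n' : nat)
    (M : manifold R n) (N : manifold R n') (f : M -> N) : Prop :=
  continuous f /\
  forall c c', atlas c -> atlas c' -> smooth_on (coord_dom f c c') (coord f c c').

Definition immersion (R : realType) (n n' : nat)
    (M : manifold R n) (N : manifold R n') (f : M -> N) : Prop :=
  smooth_map f /\
  forall (c : chart R M n) (c' : chart R N n') (x v : 'rV[R]_n),
    atlas c -> atlas c' -> coord_dom f c c' x ->
    'D_v (coord f c c') x = 0 -> v = 0.

(** * Riemannian metrics and minimal submanifolds *)

Definition bil (R : realType) (n : nat) (A : 'M[R]_n) (v w : 'rV[R]_n) : R :=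
  (v *m A *m w^T) 0 0.

(* A covariant tensor field is the family of its components in all the charts
   of the atlas, subject to the transformation law (last conjunct). *)
Definition riemannian_metric (R : realType) (n : nat) (M : manifold R n)
    (g : chart R M n -> 'rV[R]_n -> 'M[R]_n) : Prop :=
  [/\ forall c, atlas c -> smooth_on (ccod c) (g c),
      forall c x, atlas c -> ccod c x -> (g c x)^T = g c x,
      forall c x v, atlas c -> ccod c x -> v != 0 -> 0 < bil (g c x) v v &
      forall c c' x v w, atlas c -> atlas c' -> coord_dom id c c' x ->
        bil (g c x) v w =
        bil (g c' (coord id c c' x))
          ('D_v (coord id c c') x) ('D_w (coord id c c') x)].

(* i-th partial derivative of a scalar function *)
Definition partial (R : realType) (n : nat) (i : 'I_n) (f : 'rV[R]_n -> R) :
    'rV[R]_n -> R :=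
  'D_(delta_mx 0 i) (f : 'rV[R]_n -> R^o).

Definition christoffel (R : realType) (n : nat) (g : 'rV[R]_n -> 'M[R]_n)
    (x : 'rV[R]_n) (a b c : 'I_n) : R :=
  2^-1 * \sum_(e < n) invmx (g x) a e *
    (partial b (fun y => g y e c) x + partial c (fun y => g y e b) x
     - partial e (fun y => g y b c) x).

(* The mean curvature vector at f u of the immersion f into an open subset of
   R^n with metric g: the g-normal part of
     h^ij (d_i d_j f^a + Gamma^a_bc d_i f^b d_j f^c),
   where h is the metric induced by g through f. *)
Section MeanCurvature.
Variables (R : realType) (d n : nat).
Variables (g : 'rV[R]_n -> 'M[R]_n) (f : 'rV[R]_d -> 'rV[R]_n).

Definition fcomp (a : 'I_n) : 'rV[R]_d -> R := fun u => f u 0 a.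
Definition tangent (i : 'I_d) (u : 'rV[R]_d) : 'rV[R]_n :=
  \row_a partial i (fcomp a) u.

Definition induced_metric (u : 'rV[R]_d) : 'M[R]_d :=
  \matrix_(i, j) bil (g (f u)) (tangent i u) (tangent j u).

Definition covariant_hessian (u : 'rV[R]_d) (i j : 'I_d) : 'rV[R]_n :=
  \row_a (partial i (partial j (fcomp a)) u
          + \sum_(b < n) \sum_(c < n) christoffel g (f u) a b c
              * partial i (fcomp b) u * partial j (fcomp c) u).

Definition normal_part (u : 'rV[R]_d) (v : 'rV[R]_n) : 'rV[R]_n :=
  v - \sum_(k < d) \sum_(l < d)
        (invmx (induced_metric u) k l * bil (g (f u)) v (tangent k u))
          *: tangent l u.

Definition mean_curvature (u : 'rV[R]_d) : 'rV[R]_n :=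
  normal_part u (\sum_(i < d) \sum_(j < d)
    invmx (induced_metric u) i j *: covariant_hessian u i j).

End MeanCurvature.

Definition minimal_immersion (R : realType) (d n : nat)
    (S : manifold R d) (M : manifold R n)
    (g : chart R M n -> 'rV[R]_n -> 'M[R]_n) (f : S -> M) : Prop :=
  immersion f /\
  forall (c : chart R S d) (c' : chart R M n) (u : 'rV[R]_d),
    atlas c -> atlas c' -> coord_dom f c c' u ->
    mean_curvature (g c') (coord f c c') u = 0.

(* N is a d-dimensional compact minimal submanifold, given by an immersion of a
   compact manifold; embedded submanifolds are the case where f is injective. *)
Definition compact_minimal_submanifold (R : realType) (d n : nat)
    (M : manifold R n) (g : chart R M n -> 'rV[R]_n -> 'M[R]_n)
    (N : set M) : Prop :=
  exists (S : manifold R d) (f : S -> M),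
    [/\ compact [set: S], minimal_immersion g f & N = range f].

(** * The Gibbons-Hawking ansatz *)

(* The library norm on 'rV[R]_n is the sup norm, hence this definition. *)
Definition dot (R : realType) (n : nat) (x y : 'rV[R]_n) : R :=
  \sum_(i < n) x 0 i * y 0 i.

Definition enorm (R : realType) (n : nat) (x : 'rV[R]_n) : R :=
  Num.sqrt (dot x x).

Section GibbonsHawking.
Variables (R : realType) (k : nat) (m : R) (p : 'I_k -> 'rV[R]_3).

Definition punctured_space : set 'rV[R]_3 := [set x | forall i, x <> p i].

Definition potential (x : 'rV[R]_3) : R :=
  m + \sum_(i < k) (2 * enorm (x - p i))^-1.

(* ( * d potential)_x (u, v) = vol (grad potential, u, v) *)
Definition star_dpotential (x u v : 'rV[R]_3) : R :=
  \det (\matrix_(i < 3, j < 3)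
    (nth 0 [:: \row_l partial l potential x; u; v] i) 0 j).

(* The S^1 = R / 2 pi Z action is a 2 pi-periodic action of R. *)
Definition smooth_circle_action (X : manifold R 4) (act : R -> X -> X) : Prop :=
  [/\ forall q, act 0 q = q /\ act (2 * pi) q = q,
      forall s t q, act (s + t) q = act s (act t q),
      continuous (fun y : R * X => act y.1 y.2) &
      forall c c', atlas c -> atlas c' ->
        smooth_on (V := (R^o * 'rV[R]_4)%type)
          [set y | ccod c y.2 /\ cdom c' (act y.1 (cinv c y.2))]
          (fun y => cmap c' (act y.1 (cinv c y.2)))].

(* Over V, the S^1-equivariant diffeomorphism V * S^1 -> proj @^-1` V is the
   2 pi-periodic map (x, t) |-> Phi x t; it is a diffeomorphism when its
   restrictions to the strips |t - t0| < pi are inverses of smooth charts. *)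
Definition local_trivialization (X : manifold R 4)
    (proj : X -> 'rV[R]_3) (act : R -> X -> X)
    (V : set 'rV[R]_3) (Phi : 'rV[R]_3 -> R -> X) : Prop :=
  [/\ forall x t, V x -> proj (Phi x t) = x,
      forall x s t, V x -> Phi x (s + t) = act s (Phi x t),
      forall x s t, V x ->
        (Phi x s = Phi x t <-> exists z : int, s = t + z%:~R * (2 * pi)),
      forall q, V (proj q) -> exists t, q = Phi (proj q) t &
      forall t0, exists c : chart R X 4,
        [/\ atlas c,
            ccod c = [set y | exists x t, [/\ V x, `|t - t0| < pi &
                                 y = (row_mx x t%:M : 'rV[R]_(3 + 1))]] &
            forall x t, V x -> `|t - t0| < pi ->
              cinv c (row_mx x t%:M : 'rV[R]_(3 + 1)) = Phi x t]].

Definition principal_circle_bundle (X : manifold R 4)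
    (proj : X -> 'rV[R]_3) (act : R -> X -> X) : Prop :=
  forall x, punctured_space x -> exists V Phi,
    [/\ open V, V x, V `<=` punctured_space &
        local_trivialization proj act V Phi].

(* value on v of the 1-form with components eta c in the chart c *)
Definition ev1 (X : manifold R 4) (eta : chart R X 4 -> 'rV[R]_4 -> 'cV[R]_4)
    (c : chart R X 4) (v x : 'rV[R]_4) : R :=
  (v *m eta c x) 0 0.

Definition ext_deriv (X : manifold R 4)
    (eta : chart R X 4 -> 'rV[R]_4 -> 'cV[R]_4)
    (c : chart R X 4) (u v x : 'rV[R]_4) : R :=
  'D_u (ev1 eta c v : 'rV[R]_4 -> R^o) x - 'D_v (ev1 eta c u : 'rV[R]_4 -> R^o) x.

Definition generator (X : manifold R 4) (act : R -> X -> X)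
    (c : chart R X 4) (x : 'rV[R]_4) : 'rV[R]_4 :=
  derive1 (fun t : R => cmap c (act t (cinv c x))) 0.

(* For t = 0, the third conjunct is the transformation law of a 1-form. *)
Definition connection_form (X : manifold R 4) (X0 : set X) (act : R -> X -> X)
    (eta : chart R X 4 -> 'rV[R]_4 -> 'cV[R]_4) : Prop :=
  [/\ forall c, atlas c -> smooth_on (ccod c `&` cinv c @^-1` X0) (eta c),
      forall c x, atlas c -> ccod c x -> X0 (cinv c x) ->
        ev1 eta c (generator act c x) x = 1 &
      forall t c c' x v, atlas c -> atlas c' ->
        coord_dom (act t) c c' x -> X0 (cinv c x) ->
        ev1 eta c v x =
        ev1 eta c' ('D_v (coord (act t) c c') x) (coord (act t) c c' x)].

(* (X, g) for the centers p and the constant m: multi-Eguchi-Hanson if m = 0,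
   multi-Taub-NUT if m > 0.  The smooth structure at the added points is pinned
   down by the smoothness of the metric there. *)
Record gibbons_hawking := GibbonsHawking {
  gh_space :> manifold R 4;
  gh_metric : chart R gh_space 4 -> 'rV[R]_4 -> 'M[R]_4;
  gh_proj : gh_space -> 'rV[R]_3;
  gh_act : R -> gh_space -> gh_space;
  gh_conn : chart R gh_space 4 -> 'rV[R]_4 -> 'cV[R]_4;

  gh_metricP : riemannian_metric gh_metric;
  gh_actP : smooth_circle_action gh_act;
  gh_proj_continuous : continuous gh_proj;
  gh_proj_smooth : forall c, atlas c -> smooth_on (ccod c) (gh_proj \o cinv c);
  gh_proj_act : forall t q, gh_proj (gh_act t q) = gh_proj q;

  gh_bundle : principal_circle_bundle gh_proj gh_act;
  gh_added_point : forall i, exists q, gh_proj @^-1` [set p i] = [set q];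

  gh_connP :
    connection_form (gh_proj @^-1` punctured_space) gh_act gh_conn;
  gh_curvature : forall c x u v,
    atlas c -> ccod c x -> punctured_space (gh_proj (cinv c x)) ->
    ext_deriv gh_conn c u v x =
    star_dpotential (gh_proj (cinv c x))
      ('D_u (gh_proj \o cinv c) x) ('D_v (gh_proj \o cinv c) x);
  gh_metricE : forall c x u v,
    atlas c -> ccod c x -> punctured_space (gh_proj (cinv c x)) ->
    bil (gh_metric c x) u v =
    (potential (gh_proj (cinv c x)))^-1
      * (ev1 gh_conn c u x * ev1 gh_conn c v x)
    + potential (gh_proj (cinv c x))
      * dot ('D_u (gh_proj \o cinv c) x) ('D_v (gh_proj \o cinv c) x)
}.

Definition circle_invariant (X : gibbons_hawking) (N : set X) : Prop :=
  forall t q, N q -> N (gh_act t q).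

End GibbonsHawking.

Definition segment (R : realType) (n : nat) (a b : 'rV[R]_n) : set 'rV[R]_n :=
  [set x | exists t : R, 0 <= t <= 1 /\ x = (1 - t) *: a + t *: b].

(* The unique circle-invariant compact minimal surface for two centers. *)
Definition minimal_sphere (R : realType) (m : R) (p : 'I_2 -> 'rV[R]_3)
    (X : gibbons_hawking m p) : set X :=
  @gh_proj R 2 m p X @^-1` segment (p ord0) (p ord_max).

(* Main.v *)
(* Let F = |x - p_1| + |x - p_2|, pulled back to X.  Away from the preimage of the
   segment [p_1, p_2] the Hessian of F for the Gibbons-Hawking metric is positive
   definite.  On a compact minimal submanifold F attains a maximum; there the
   intrinsic Laplacian of F is nonpositive, whereas by minimality it is the trace
   of the ambient Hessian over the tangent space, hence positive off the segment.
   So the maximum lies over the segment, where F takes its global minimum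
   |p_1 - p_2|, and the whole submanifold lies over the segment. *)
Require Import Defs.
From mathcomp Require Import all_boot all_order all_algebra.
From mathcomp Require Import all_classical all_reals all_analysis.
From mathcomp Require Import ring lra.

Set Implicit Arguments.
Unset Strict Implicit.
Unset Printing Implicit Defensive.

Import Order.TTheory GRing.Theory Num.Theory.
Import numFieldNormedType.Exports.

Local Open Scope classical_set_scope.
Local Open Scope ring_scope.

(** The connection form eta is known only through its curvature, so the Hessian cannot be read off
    from explicit Christoffel symbols. Paired with dF, these reduce to D_v g(W, v) - D_W g(v, v) /
    2, where W is the gradient of F and v, W are frozen in the chart. Since F is constant on the
    orbits, W is horizontal; the derivatives of eta then occur only in the combination d eta (v, W),
    which the curvature equation evaluates. What remains is a quadratic form in the horizontal part
    of v and a vertical coordinate tau. Its one cross term carries a determinant whose square is a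
    Gram determinant, and this identity makes the form positive. The comparison of Laplacians
    becomes a statement about a single direction w: minimality provides a w for which dF is
    nonnegative on the covariant second derivative, while the maximum bounds the ordinary one from
    above. F is not differentiable over the centers, but these are the endpoints of the segment, so
    a maximum off the segment avoids them. *)

(** * Positive definite matrices *)

Lemma bil_block_mx (R : realType) (n : nat) (a b : R) (r v : 'rV[R]_n)
    (D : 'M[R]_n) :
  bil (block_mx a%:M r r^T D) (row_mx b%:M v) (row_mx b%:M v) =
  b * b * a + 2 * b * (r *m v^T) 0 0 + bil D v v.
Proof.
have vr : v *m r^T = r *m v^T.
  rewrite -[LHS]trmxK trmx_mul trmxK [r *m _]mx11_scalar.
  by rewrite tr_scalar_mx.
rewrite /bil mul_row_block tr_row_mx mul_row_col !mulmxDl !mul_scalar_mx.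
rewrite tr_scalar_mx !mul_mx_scalar -!scalemxAl vr.
move: (r *m _) (v *m D *m _) => M1 M2; rewrite !mxE eqxx mulr1n; ring.
Qed.

(** Induction through the Schur complement [D - a^-1 *: (r^T *m r)] of the top left entry, which is
    again symmetric and positive definite. *)
Lemma posdef_cholesky (R : realType) (n : nat) (A : 'M[R]_n) :
  A^T = A -> (forall v, v != 0 -> 0 < bil A v v) ->
  exists B : 'M[R]_n, A = B^T *m B.
Proof.
elim: n A => [|n IH] A symA posA.
  by exists 0; rewrite !flatmx0.
pose a := A 0 0; pose r : 'rV[R]_n := @ursubmx _ 1 n 1 n A.
pose D : 'M[R]_n := @drsubmx _ 1 n 1 n A.
have ulA : @ulsubmx _ 1 n 1 n A = a%:M.
  rewrite [LHS]mx11_scalar; congr (_%:M).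
  by rewrite !mxE; congr (A _ _); apply/val_inj.
have AE : A = block_mx a%:M r r^T D.
  rewrite -[LHS](@submxK _ 1 n 1 n) ulA /r trmx_ursub.
  by rewrite [A^T]symA.
have symD : D^T = D by rewrite /D trmx_drsub symA.
have bilA (b : R) (v : 'rV[R]_n) : bil A (row_mx b%:M v) (row_mx b%:M v) =
    b * b * a + 2 * b * (r *m v^T) 0 0 + bil D v v.
  by rewrite AE; exact: bil_block_mx.
have a_gt0 : 0 < a.
  have := posA (row_mx 1%:M 0); rewrite bilA /bil !mul0mx trmx0 !mulmx0 !mxE.
  rewrite !mulr0 !addr0 !mul1r; apply.
  apply/eqP => /(congr1 (@lsubmx _ 1 1 n)).
  by rewrite row_mxKl linear0 => /matrixP/(_ 0 0)/eqP; rewrite !mxE oner_eq0.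
have [||B' DE] := IH (D - a^-1 *: (r^T *m r)).
- by rewrite linearB linearZ /= trmx_mul trmxK symD.
(* The first coordinate chosen here minimizes the form for fixed [v], and the minimum is the Schur
   complement at [v]. *)
- move=> v v0; have := posA (row_mx (- (a^-1 * (r *m v^T) 0 0))%:M v).
  rewrite bilA [X in _ -> 0 < X](_ : _ = bil D v v - a^-1 * ((r *m v^T) 0 0) ^+ 2).
    rewrite [X in (_ -> 0 < X) -> _](_ : _ =
      bil D v v - a^-1 * ((r *m v^T) 0 0) ^+ 2); last by field; rewrite gt_eqF.
    apply; apply: contraNneq v0 => /(congr1 (@rsubmx _ 1 1 n)).
    by rewrite row_mxKr linear0 => ->.
  have vr : v *m r^T = (r *m v^T) 0 0 *: 1%:M.
    rewrite -[v *m r^T]trmxK trmx_mul trmxK [r *m v^T]mx11_scalar.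
    by rewrite tr_scalar_mx scalemx1 !mxE eqxx mulr1n.
  rewrite /bil mulmxBr mulmxBl mxE; congr (_ + _).
  rewrite -scalemxAr -scalemxAl mulmxA vr -scalemxAl mul1mx -scalemxAl !mxE.
  by rewrite expr2.
have sa0 : Num.sqrt a != 0 by rewrite sqrtr_eq0 -ltNge.
pose B : 'M[R]_(1 + n) := block_mx (Num.sqrt a)%:M ((Num.sqrt a)^-1 *: r) 0 B'.
exists B; rewrite AE; apply: esym; change (B^T *m B = block_mx a%:M r r^T D).
rewrite /B tr_block_mx mulmx_block.
have -> : ((Num.sqrt a)^-1 *: r)^T = (Num.sqrt a)^-1 *: r^T by rewrite linearZ.
rewrite tr_scalar_mx !trmx0 !mul0mx !mulmx0 !addr0.
rewrite -scalar_mxM -expr2 sqr_sqrtr ?ltW//.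
rewrite mul_scalar_mx mul_mx_scalar !scalerA divff// !scale1r.
rewrite -scalemxAl -scalemxAr scalerA -invfM -expr2 sqr_sqrtr ?ltW//.
by rewrite -DE addrC subrK.
Qed.

Lemma posdef_unitmx (R : realType) (n : nat) (A : 'M[R]_n) :
  (forall v, v != 0 -> 0 < bil A v v) -> A \in unitmx.
Proof.
move=> posA; rewrite -row_free_unit -kermx_eq0; apply/eqP/row_matrixP => i.
apply/eqP/negPn/negP; rewrite row0 => /posA.
by rewrite /bil -row_mul mulmx_ker row0 mul0mx mxE ltxx.
Qed.

(** [invmx A] takes at [v] the value of [A] at [v *m invmx A], so it is positive definite as well.
    The size is a successor because [B != 0] fails for empty matrices. *)
Lemma posdef_invmx_cholesky (R : realType) (n : nat) (A : 'M[R]_n.+1) :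
  A^T = A -> (forall v, v != 0 -> 0 < bil A v v) ->
  exists2 B : 'M[R]_n.+1, invmx A = B^T *m B & B != 0.
Proof.
move=> symA posA; have uA := posdef_unitmx posA.
have symV : (invmx A)^T = invmx A by rewrite trmx_inv symA.
have [|B BE] := posdef_cholesky symV.
  move=> v v0; have := posA (v *m invmx A); rewrite /bil mulmxKV// trmx_mul symV.
  rewrite mulmxA; apply.
  by apply: contraNneq v0 => /(congr1 (mulmx^~ A)); rewrite mulmxKV// mul0mx => ->.
exists B => //; apply/eqP => B0.
have := mulVmx uA; rewrite BE B0 mulmx0 mul0mx => /matrixP/(_ 0 0)/eqP.
by rewrite !mxE eqxx eq_sym oner_eq0.
Qed.

(** * Second derivative test in one variable *)

(** If [d2] were positive, [df] would be positive just to the right of 0, and the mean value theorem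
    would produce a value of [f] above [f 0]. *)
Lemma second_derivative_test (R : realType) (f df : R -> R) (d2 : R) :
  (\forall t \near (0 : R), is_derive (t : R) 1 f (df t)) ->
  is_derive (0 : R) 1 df d2 ->
  (\forall t \near 0, f t <= f 0) -> df 0 = 0 /\ d2 <= 0.
Proof.
move=> fdf dfd2 fmax.
have [e e0 fe] : exists2 e, 0 < e & forall t : R, `|t| < e ->
    is_derive (t : R) 1 f (df t) /\ f t <= f 0.
  have /nbhs_ballP[e /= e0 fe] : \forall t \near (0 : R),
      is_derive (t : R) 1 f (df t) /\ f t <= f 0.
    by near=> t; split; near: t.
  by exists e => // t te; apply: fe; rewrite -ball_normE /= sub0r normrN.
have itvE t : t \in `]-e, e[%R -> `|t| < e.
  by rewrite in_itv /= ltr_norml.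
have in0 : 0 \in `]-e, e[%R by rewrite in_itv /= oppr_lt0 e0.
have df0 : df 0 = 0.
  have [_ <-] : is_derive (0 : R) 1 f (df 0) by apply: (fe _ _).1; rewrite normr0.
  have [_ ->//] : is_derive (0 : R) 1 f 0.
  apply: (@derive1_at_max R f (- e) e) => //.
  - by rewrite (@le_trans _ _ 0)// ?oppr_le0 ltW.
  - by move=> t /itvE /fe [? _]; exact: ex_derive.
  - by move=> t /itvE /fe [_ ?].
split=> //; rewrite leNgt; apply/negP => d2_gt0.
have /nbhs_ballP[r /= r0 dfr] : \forall h \near 0^',
    0 < h^-1 *: (df (h *: 1 + 0) - df 0).
  case: dfd2 => dd; rewrite /derive => dE.
  apply: (cvgr_gt d2); last exact: d2_gt0.
  by rewrite -dE; exact: dd.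
pose h := Num.min (e / 2) (r / 2).
have h_gt0 : 0 < h by rewrite lt_min !divr_gt0.
have he : h < e by rewrite gt_min ltr_pdivrMr// mulr2n mulrDr mulr1 ltrDl e0.
have hr : h < r.
  by rewrite gt_min orbC ltr_pdivrMr// mulr2n mulrDr mulr1 ltrDl r0.
have fd t : 0 <= t <= h -> is_derive (t : R) 1 f (df t).
  move=> /andP[t0 th]; apply: (fe _ _).1.
  by rewrite ger0_norm// (le_lt_trans th).
have [|||c] := @MVT R f df 0 h.
- exact: h_gt0.
- by move=> t; rewrite in_itv /= => /andP[t0 th]; apply: fd; rewrite !ltW.
- apply: derivable_within_continuous => t; rewrite in_itv /= => th.
  by have [] := fd t th.
rewrite in_itv /= => /andP[c0 ch] fE.
have [_] : is_derive h 1 f (df h) /\ f h <= f 0.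
  by apply: fe; rewrite gtr0_norm.
rewrite -subr_le0 fE subr0 pmulr_lle0// leNgt => /negP; apply.
have : 0 < c^-1 *: (df (c *: 1 + 0) - df 0).
  apply: dfr; last by rewrite /= gt_eqF.
  by rewrite -ball_normE /= sub0r normrN gtr0_norm// (lt_trans ch).
by rewrite df0 subr0 addr0 [c *: 1]mulr1 pmulr_rgt0// invr_gt0.
Unshelve. all: by end_near. Qed.

(** * Christoffel symbols paired with a covector *)

Lemma bilE (R : realType) (n : nat) (A : 'M[R]_n) (v w : 'rV[R]_n) :
  bil A v w = \sum_(i < n) \sum_(j < n) v 0 i * w 0 j * A i j.
Proof.
rewrite /bil mxE.
under eq_bigr do rewrite !mxE mulr_suml.
rewrite exchange_big; apply: eq_bigr => i _; apply: eq_bigr => j _; ring.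
Qed.

Lemma derive_partial (R : realType) (n : nat) (f : 'rV[R]_n -> R^o)
    (x v : 'rV[R]_n) :
  differentiable f x -> 'D_v f x = \sum_(b < n) v 0 b * partial b f x.
Proof.
move=> df; rewrite deriveE// [in LHS](row_sum_delta v) linear_sum.
by apply: eq_bigr => b _; rewrite linearZ /partial deriveE.
Qed.

Lemma derive_bil (R : realType) (n : nat) (g : 'rV[R]_n -> 'M[R]_n)
    (x w u v : 'rV[R]_n) :
  differentiable g x ->
  'D_v (fun y => bil (g y) w u : R^o) x =
  \sum_(e < n) \sum_(c < n) \sum_(b < n)
     w 0 e * u 0 c * v 0 b * partial b (fun y => g y e c) x.
Proof.
move=> dg.
have dgij i j : differentiable (fun y => g y i j : R^o) x.
  exact: (@differentiable_comp _ _ _ R^o g (fun N : 'M[R]_n => N i j : R^o)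
    x dg (differentiable_coord _ _ _)).
apply: derive_val.
rewrite [X in is_derive _ _ X](_ : _ =
  \sum_(e < n) \sum_(c < n) (w 0 e * u 0 c) *: (fun y => g y e c : R^o)); last first.
  rewrite funeqE => y; rewrite bilE fct_sumE; apply: eq_bigr => i _.
  by rewrite fct_sumE.
apply: is_derive_sum => e; apply: is_derive_sum => c.
have -> : \sum_(b < n) w 0 e * u 0 c * v 0 b * partial b (fun y => g y e c) x =
   (w 0 e * u 0 c) *: 'D_v (fun y => g y e c : R^o) x.
  rewrite derive_partial// scaler_sumr; apply: eq_bigr => b _.
  by rewrite [RHS]mulrA.
by apply: is_deriveZ; apply/derivableP/diff_derivable.
Qed.

(** The Koszul formula for constant fields: [w *m invmx (g x)] is the vector dual to the covector
    [w], kept fixed while the metric is differentiated. Only derivatives of values of the metric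
    remain, and these values are what the Gibbons-Hawking ansatz prescribes. *)
Lemma christoffel_contraction (R : realType) (n : nat)
    (g : 'rV[R]_n -> 'M[R]_n) (x w v : 'rV[R]_n) :
  differentiable g x ->
  \sum_(a < n) w 0 a *
    (\sum_(b < n) \sum_(c < n) christoffel g x a b c * v 0 b * v 0 c) =
  'D_v (fun y => bil (g y) (w *m invmx (g x)) v : R^o) x
  - 2^-1 * 'D_(w *m invmx (g x)) (fun y => bil (g y) v v : R^o) x.
Proof.
move=> dg; rewrite !derive_bil//; set W := w *m invmx (g x).
pose T b e c := partial b (fun y => g y e c) x.
have -> : \sum_(a < n) w 0 a *
    (\sum_(b < n) \sum_(c < n) christoffel g x a b c * v 0 b * v 0 c) =
  \sum_(b < n) \sum_(c < n) \sum_(e < n)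
    (2^-1 * (v 0 b * v 0 c * W 0 e * T b e c)
     + 2^-1 * (v 0 b * v 0 c * W 0 e * T c e b)
     - 2^-1 * (v 0 b * v 0 c * W 0 e * T e b c)).
  under eq_bigr do rewrite mulr_sumr.
  rewrite exchange_big; apply: eq_bigr => b _.
  under eq_bigr do rewrite mulr_sumr.
  rewrite exchange_big; apply: eq_bigr => c _.
  rewrite /christoffel.
  under eq_bigr do rewrite mulr_sumr mulr_suml mulr_suml mulr_sumr.
  rewrite exchange_big; apply: eq_bigr => e _.
  rewrite [RHS](_ : _ = W 0 e *
    (2^-1 * (v 0 b * v 0 c) * (T b e c + T c e b - T e b c))); last by ring.
  rewrite /W mxE.
  rewrite !(mulr_sumr, mulr_suml); apply: eq_bigr => a _.
  by rewrite /T; ring.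
have E1 : \sum_(e < n) \sum_(c < n) \sum_(b < n) W 0 e * v 0 c * v 0 b * T b e c =
    \sum_(b < n) \sum_(c < n) \sum_(e < n) v 0 b * v 0 c * W 0 e * T b e c.
  rewrite exchange_big [RHS]exchange_big; apply: eq_bigr => c _.
  rewrite exchange_big; apply: eq_bigr => b _; apply: eq_bigr => e _; ring.
(* The terms in [T b e c] and [T c e b] contract equally because [v 0 b * v 0 c] is symmetric, so
   their two halves add up to the ['D_v] term. *)
have E2 : \sum_(b < n) \sum_(c < n) \sum_(e < n) v 0 b * v 0 c * W 0 e * T c e b =
    \sum_(b < n) \sum_(c < n) \sum_(e < n) v 0 b * v 0 c * W 0 e * T b e c.
  rewrite exchange_big; apply: eq_bigr => c _; apply: eq_bigr => b _.
  by apply: eq_bigr => e _; ring.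
rewrite E1.
have -> : \sum_(e < n) \sum_(c < n) \sum_(b < n)
     v 0 e * v 0 c * W 0 b * partial b (fun y => g y e c) x =
   \sum_(b < n) \sum_(c < n) \sum_(e < n) v 0 b * v 0 c * W 0 e * T e b c by [].
under eq_bigr do under eq_bigr do rewrite !big_split /=.
under eq_bigr do rewrite !big_split /=.
rewrite !big_split /=.
have half (F : 'I_n -> 'I_n -> 'I_n -> R) :
    \sum_(b < n) \sum_(c < n) \sum_(e < n) 2^-1 * F b c e =
    2^-1 * \sum_(b < n) \sum_(c < n) \sum_(e < n) F b c e.
  by rewrite !mulr_sumr; apply: eq_bigr => b _; rewrite !mulr_sumr;
    apply: eq_bigr => c _; rewrite mulr_sumr.
rewrite !half E2.
have -> : \sum_(b < n) \sum_(c < n) \sum_(e < n)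
    - (2^-1 * (v 0 b * v 0 c * W 0 e * T e b c))
  = - (2^-1 * \sum_(b < n) \sum_(c < n) \sum_(e < n) v 0 b * v 0 c * W 0 e * T e b c).
  rewrite -half -sumrN; apply: eq_bigr => b _.
  by rewrite -sumrN; apply: eq_bigr => c _; rewrite -sumrN.
set S1 := \sum_(_ < n) _; set S2 := \sum_(_ < n) _; lra.
Qed.

(** * Positivity of the Hessian as a scalar inequality *)

(** [c], [n], [al], [be], [D] stand for a.b, |v|^2, a.v, b.v and det (a, v, b) with unit vectors a
    and b. Then [DE] is the Gram determinant, [CS] is Cauchy-Schwarz for a - b and v, and [-1 < c]
    says that a and b are not opposite. When [n = 0] the vector is vertical and only the [tau ^+ 2]
    term survives. *)
Lemma hessian_form_gt0 (R : realFieldType) (c s t n al be D tau : R) :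
  -1 < c -> 0 < s -> 0 < t -> 0 <= n ->
  D ^+ 2 = (1 - c ^+ 2) * n - al ^+ 2 - be ^+ 2 + 2 * c * al * be ->
  (al - be) ^+ 2 <= 2 * (1 - c) * n ->
  (n = 0 -> [/\ al = 0, be = 0 & tau != 0]) ->
  0 < (2 * (s + t) ^+ 2 - (1 + c) * (s ^+ 2 + t ^+ 2)) * n
      - 2 * s * t * (al ^+ 2 + be ^+ 2) + 2 * (s ^+ 2 + t ^+ 2) * al * be
      + 2 * (s ^+ 2 - t ^+ 2) * tau * D
      + (1 + c) * (s ^+ 2 + t ^+ 2) * tau ^+ 2.
Proof.
move=> c1 s0 t0 n0 DE CS nul.
have c1' : 0 < 1 + c by lra.
have st0 : 0 < s * t by rewrite mulr_gt0.
have ss0 : 0 < s ^+ 2 + t ^+ 2 by rewrite addr_gt0// exprn_gt0.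
pose k := (1 + c) * (s ^+ 2 + t ^+ 2).
have k0 : 0 < k by rewrite mulr_gt0.
set Q := (X in 0 < X).
move: n0; rewrite le_eqVlt => /orP[/eqP nE|n0].
  have [al0 be0 tau0] := nul (esym nE).
  have D0 : D = 0.
    by apply/eqP; rewrite -sqrf_eq0 DE -nE al0 be0; apply/eqP; ring.
  have -> : Q = k * tau ^+ 2 by rewrite /Q /k -nE al0 be0 D0; ring.
  by rewrite mulr_gt0// exprn_even_gt0.
rewrite -(pmulr_rgt0 _ k0).
(* completing the square in tau *)
have -> : k * Q = (k * tau + (s ^+ 2 - t ^+ 2) * D) ^+ 2
    + (1 + c) ^+ 2 * (2 * s * t * (s ^+ 2 + t ^+ 2)) * n
    + (1 + c) * (s + t) ^+ 2 * (s * t) * (2 * (1 - c) * n - (al - be) ^+ 2)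
    + (k * (s - t) ^+ 2 / 2 + (s ^+ 2 - t ^+ 2) ^+ 2 * (1 - c) / 2)
        * (al + be) ^+ 2
    + (s ^+ 2 - t ^+ 2) ^+ 2 *
       ((1 - c ^+ 2) * n - al ^+ 2 - be ^+ 2 + 2 * c * al * be - D ^+ 2).
  by rewrite /Q /k; field.
(* The last term vanishes by [DE]. Of the others, the second is strictly positive and the rest are
   nonnegative. *)
rewrite DE subrr mulr0 addr0.
(* The upper bound on [c] comes from [CS], since [n] is positive in this branch. *)
have c1'' : 0 <= 1 - c.
  have : 0 <= 2 * (1 - c) * n by rewrite (le_trans _ CS)// sqr_ge0.
  by rewrite pmulr_lge0// pmulr_rge0.
rewrite ltr_wpDr//; last rewrite ltr_wpDr//; last rewrite ltr_wpDl ?sqr_ge0//.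
- apply: mulr_ge0; last exact: sqr_ge0.
  apply: addr_ge0; apply: mulr_ge0; rewrite ?invr_ge0//.
    by rewrite mulr_ge0 ?sqr_ge0// ltW.
  by rewrite mulr_ge0 ?sqr_ge0.
- by rewrite mulr_ge0 ?subr_ge0// mulr_ge0 ?(ltW st0)// mulr_ge0 ?sqr_ge0// ltW.
- by rewrite !mulr_gt0 ?exprn_gt0.
Qed.

(** * Euclidean vector algebra *)

Lemma dotC (R : realType) (n : nat) (x y : 'rV[R]_n) : dot x y = dot y x.
Proof. by apply: eq_bigr => i _; rewrite mulrC. Qed.

Lemma dotDl (R : realType) (n : nat) (x y z : 'rV[R]_n) :
  dot (x + y) z = dot x z + dot y z.
Proof. by rewrite -big_split; apply: eq_bigr => i _; rewrite mxE mulrDl. Qed.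

Lemma dotZl (R : realType) (n : nat) (k : R) (x y : 'rV[R]_n) :
  dot (k *: x) y = k * dot x y.
Proof. by rewrite mulr_sumr; apply: eq_bigr => i _; rewrite mxE mulrA. Qed.

Lemma dotDr (R : realType) (n : nat) (x y z : 'rV[R]_n) :
  dot z (x + y) = dot z x + dot z y.
Proof. by rewrite ![dot z _]dotC dotDl. Qed.

Lemma dotZr (R : realType) (n : nat) (k : R) (x y : 'rV[R]_n) :
  dot x (k *: y) = k * dot x y.
Proof. by rewrite ![dot x _]dotC dotZl. Qed.

Lemma dot_ge0 (R : realType) (n : nat) (x : 'rV[R]_n) : 0 <= dot x x.
Proof. by apply: sumr_ge0 => i _; rewrite -expr2 sqr_ge0. Qed.

Lemma dot_eq0 (R : realType) (n : nat) (x : 'rV[R]_n) : dot x x = 0 -> x = 0.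
Proof.
move=> /eqP; rewrite psumr_eq0; last by move=> i _; rewrite -expr2 sqr_ge0.
move=> /allP x0; apply/rowP => i; rewrite mxE; apply/eqP.
by have := x0 i; rewrite mem_index_enum -expr2 sqrf_eq0; apply.
Qed.

Lemma dot0l (R : realType) (n : nat) (x : 'rV[R]_n) : dot 0 x = 0.
Proof. by rewrite /dot big1// => i _; rewrite mxE mul0r. Qed.

Lemma cauchy_schwarz (R : realType) (n : nat) (x y : 'rV[R]_n) :
  dot x y ^+ 2 <= dot x x * dot y y.
Proof.
have := dot_ge0 x; rewrite le_eqVlt => /orP[/eqP/esym x0|x0].
  by rewrite x0 (dot_eq0 x0) dot0l expr2 !mul0r.
have := dot_ge0 (y + - (dot x y / dot x x) *: x).
rewrite !dotDl !dotDr !dotZl !dotZr [dot y x]dotC.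
rewrite [X in 0 <= X](_ : _ = (dot x x * dot y y - dot x y ^+ 2) / dot x x).
  by rewrite pmulr_lge0 ?invr_gt0// subr_ge0.
by field; rewrite gt_eqF.
Qed.

Lemma det_row3 (R : realType) (x y z : 'rV[R]_3) :
  \det (\matrix_(i < 3, j < 3) (nth 0 [:: x; y; z] i) 0 j) =
    x 0 0 * (y 0 1 * z 0 (inord 2) - y 0 (inord 2) * z 0 1)
  - x 0 1 * (y 0 0 * z 0 (inord 2) - y 0 (inord 2) * z 0 0)
  + x 0 (inord 2) * (y 0 0 * z 0 1 - y 0 1 * z 0 0).
Proof.
pose f (u : 'rV[R]_3) k := u 0 (inord k).
have fE (u : 'rV[R]_3) i : u 0 i = f u i by rewrite /f inord_val.
do 2 rewrite ?(expand_det_row _ ord0) !big_ord_recl !big_ord0 /cofactor.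
rewrite !det_mx11 !mxE /= !fE /= !inordK// /bump /=.
rewrite ?(_ : nat_of_ord (1 : 'I_3) = 1%N)//; ring.
Qed.

Lemma dot3E (R : realType) (x y : 'rV[R]_3) :
  dot x y = x 0 0 * y 0 0 + x 0 1 * y 0 1 + x 0 (inord 2) * y 0 (inord 2).
Proof.
pose f (u : 'rV[R]_3) k := u 0 (inord k).
have fE (u : 'rV[R]_3) i : u 0 i = f u i by rewrite /f inord_val.
rewrite /dot !big_ord_recl !big_ord0 /= !fE /= !inordK// /bump /=.
rewrite ?(_ : nat_of_ord (1 : 'I_3) = 1%N)//; ring.
Qed.

Definition det3 (R : realType) (x y z : 'rV[R]_3) : R :=
  \det (\matrix_(i < 3, j < 3) (nth 0 [:: x; y; z] i) 0 j).

Lemma det3Zr (R : realType) (k : R) (x y z : 'rV[R]_3) :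
  det3 x y (k *: z) = k * det3 x y z.
Proof. by rewrite /det3 !det_row3 !mxE; ring. Qed.

Lemma det3_gram (R : realType) (a v b : 'rV[R]_3) : det3 a v b ^+ 2 =
  dot a a * dot b b * dot v v + 2 * dot a b * dot a v * dot b v
  - dot a a * dot b v ^+ 2 - dot b b * dot a v ^+ 2 - dot v v * dot a b ^+ 2.
Proof. by rewrite /det3 det_row3 !dot3E; ring. Qed.

(* With a, b the unit vectors from the centers, s, t the inverse distances to them
   and phi = m + (s + t) / 2, this is phi times the Hessian of F on the tangent
   vector with horizontal part v and vertical part eta = phi tau. *)
Lemma two_center_form_gt0 (R : realType) (a b v : 'rV[R]_3)
    (m s t tau : R) (dphi := - 2^-1 *: (s ^+ 2 *: a + t ^+ 2 *: b)) :
  dot a a = 1 -> dot b b = 1 -> a + b != 0 -> 0 <= m -> 0 < s -> 0 < t ->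
  (v = 0 -> tau != 0) ->
  0 < (m + (s + t) / 2) * (s * (dot v v - dot a v ^+ 2)
                         + t * (dot v v - dot b v ^+ 2))
      - tau * det3 dphi v (a + b)
      - dot dphi v * dot (a + b) v
      - 2^-1 * dot dphi (a + b) * tau ^+ 2
      + 2^-1 * dot dphi (a + b) * dot v v.
Proof.
move=> a1 b1 ab0 m0 s0 t0 v0.
have detE : det3 dphi v (a + b) = - 2^-1 * (s ^+ 2 - t ^+ 2) * det3 a v b.
  by rewrite /det3 !det_row3 /dphi !mxE; ring.
have c_gt : -1 < dot a b.
  have : 0 < dot (a + b) (a + b).
    by rewrite lt_neqAle dot_ge0 andbT eq_sym; apply: contraNneq ab0 => /dot_eq0 ->.
  by rewrite !dotDl !dotDr a1 b1 [dot b a]dotC; lra.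
have CS u : dot u u = 1 -> 0 <= dot v v - dot u v ^+ 2.
  by move=> u1; rewrite subr_ge0 -[leRHS]mul1r -u1 cauchy_schwarz.
have := @hessian_form_gt0 R (dot a b) s t (dot v v) (dot a v) (dot b v)
  (det3 a v b) tau c_gt s0 t0 (dot_ge0 v).
have -> : dot dphi v = - 2^-1 * (s ^+ 2 * dot a v + t ^+ 2 * dot b v).
  by rewrite /dphi dotZl dotDl !dotZl.
have -> : dot dphi (a + b) = - 2^-1 * ((s ^+ 2 + t ^+ 2) * (1 + dot a b)).
  by rewrite /dphi dotZl dotDl !dotZl !dotDr a1 b1 [dot b a]dotC; ring.
have -> : dot (a + b) v = dot a v + dot b v by rewrite dotDl.
rewrite detE => H.
(* The constant [m] contributes only this nonnegative term, so positivity reduces to the form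
   without it. *)
have : 0 <= m * (s * (dot v v - dot a v ^+ 2) + t * (dot v v - dot b v ^+ 2)).
  by rewrite mulr_ge0// addr_ge0// mulr_ge0 ?CS// ltW.
(* Four times the remaining form, which clears the halves. *)
suff : 0 < (2 * (s + t) ^+ 2 - (1 + dot a b) * (s ^+ 2 + t ^+ 2)) * dot v v -
      2 * s * t * (dot a v ^+ 2 + dot b v ^+ 2) +
      2 * (s ^+ 2 + t ^+ 2) * dot a v * dot b v +
      2 * (s ^+ 2 - t ^+ 2) * tau * det3 a v b +
      (1 + dot a b) * (s ^+ 2 + t ^+ 2) * tau ^+ 2.
  move: (dot v v) (dot a v) (dot b v) (dot a b) (det3 a v b) => n al be c D.
  by rewrite -(pmulr_rgt0 _ (ltr0n R 4)) => ? ?; lra.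
apply: H.
- by rewrite det3_gram a1 b1; ring.
- have := cauchy_schwarz (a + - 1 *: b) v.
  rewrite !dotDl !dotDr !dotZl !dotZr a1 b1 [dot b a]dotC => H.
  rewrite (le_trans _ (le_trans H _)) ?le_eqVlt//.
    by apply/orP; left; apply/eqP; ring.
  by apply/orP; left; apply/eqP; ring.
- move=> /dot_eq0 vE; rewrite vE ![dot _ 0]dotC !dot0l; split => //; exact: v0.
Qed.

(** * Derivatives of distances and of the potential *)

(** Reduces a derivative along [v] to one real variable, where the chain rule [is_derive1_comp]
    applies. *)
Lemma is_derive_lineP (R : realType) (V W : normedModType R) (f : V -> W)
    (x v : V) (l : W) :
  is_derive x v f l <-> is_derive (0 : R) 1 (fun h : R => f (h *: v + x)) l.
Proof.
have E : (fun h : R => h^-1 *: ((f \o shift x) (h *: v) - f x)) =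
    (fun h : R => h^-1 *: (((fun h : R => f (h *: v + x)) \o shift 0) (h *: 1)
       - f (0 *: v + x))).
  by rewrite funeqE => h /=; rewrite addr0 scale0r add0r [_ *: 1]mulr1.
by split=> -[d <-]; split; rewrite /derivable /derive ?E// -?E.
Qed.

Lemma is_derive_comp_line (R : realType) (V W : normedModType R) (f : V -> W)
    (x v : V) (t : R) :
  differentiable f (t *: v + x) ->
  is_derive t 1 (fun h : R => f (h *: v + x)) ('D_v f (t *: v + x)).
Proof.
move=> df; apply/is_derive_lineP.
have /is_derive_lineP := derivableP (@diff_derivable _ _ _ f _ v df).
congr is_derive; rewrite funeqE => h.
by rewrite addrA -scalerDl [h *: 1]mulr1.
Qed.

Lemma is_derive_entry (R : realType) (V : normedModType R) (m n : nat)
    (f : V -> 'M[R]_(m, n)) (x v : V) (l : 'M[R]_(m, n)) i j :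
  is_derive x v f l -> is_derive x v (fun y => f y i j : R^o) (l i j).
Proof.
move=> [d <-]; rewrite derive_mx// mxE; apply/derivableP.
exact: (derivable_mxP _ _ _).1.
Qed.

Lemma is_derive_dot (R : realType) (V : normedModType R) (n : nat)
    (f g : V -> 'rV[R]_n) (x v : V) (df dg : 'rV[R]_n) :
  is_derive x v f df -> is_derive x v g dg ->
  is_derive x v (fun y => dot (f y) (g y) : R^o) (dot df (g x) + dot (f x) dg).
Proof.
move=> fdf gdg.
rewrite [X in is_derive _ _ X](_ : _ =
    \sum_(i < n) ((fun y => f y 0 i : R^o) * (fun y => g y 0 i : R^o))); last first.
  by rewrite funeqE => y; rewrite fct_sumE.
rewrite /dot -big_split /=; apply: is_derive_sum => i.
apply: is_derive_eq; first by apply: is_deriveM; exact: is_derive_entry.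
by rewrite /GRing.scale /=; ring.
Qed.

Lemma enorm_ge0 (R : realType) (n : nat) (x : 'rV[R]_n) : 0 <= enorm x.
Proof. exact: sqrtr_ge0. Qed.

Lemma enorm_gt0 (R : realType) (n : nat) (x : 'rV[R]_n) :
  x != 0 -> 0 < enorm x.
Proof.
move=> x0; rewrite sqrtr_gt0 lt_neqAle dot_ge0 andbT eq_sym.
by apply: contraNneq x0 => /dot_eq0 ->.
Qed.

Lemma sqr_enorm (R : realType) (n : nat) (x : 'rV[R]_n) :
  enorm x ^+ 2 = dot x x.
Proof. by rewrite sqr_sqrtr ?dot_ge0. Qed.

Lemma is_derive_enorm (R : realType) (V : normedModType R) (n : nat)
    (f : V -> 'rV[R]_n) (x v : V) (df : 'rV[R]_n) :
  is_derive x v f df -> f x != 0 ->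
  is_derive x v (fun y => enorm (f y) : R^o) (dot (f x) df / enorm (f x)).
Proof.
move=> /is_derive_lineP fdf fx0; apply/is_derive_lineP.
have := is_derive_dot fdf fdf; rewrite scale0r add0r => dotf.
have sq : is_derive (dot (f (0 *: v + x)) (f (0 *: v + x))) 1 (@Num.sqrt R)
     (2 * Num.sqrt (dot (f x) (f x)))^-1.
  rewrite scale0r add0r; apply: is_derive1_sqrt.
  by rewrite -sqr_enorm exprn_gt0// enorm_gt0.
have := @is_derive1_comp R _
  (fun h : R => dot (f (h *: v + x)) (f (h *: v + x))) 0 _ _ sq dotf.
move=> H; apply: (is_derive_eq H).
have r0 := enorm_gt0 fx0; rewrite [dot df _]dotC -/(enorm _); field.
by rewrite gt_eqF.
Qed.

Lemma is_deriveBcst (R : realType) (V W : normedModType R)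
    (f : V -> W) (x v : V) (df c : W) :
  is_derive x v f df -> is_derive x v (fun y => f y - c) df.
Proof.
move=> fdf; apply: (is_derive_eq (is_deriveB fdf (is_derive_cst c x v))).
by rewrite subr0.
Qed.

(** Off [p] this is also the gradient at [x] of the distance to [p]. *)
Definition direction (R : realType) (n : nat) (p x : 'rV[R]_n) : 'rV[R]_n :=
  (enorm (x - p))^-1 *: (x - p).

Definition grad_potential (R : realType) (k : nat) (p : 'I_k -> 'rV[R]_3)
    (x : 'rV[R]_3) : 'rV[R]_3 :=
  - 2^-1 *: \sum_(i < k) (enorm (x - p i))^-1 ^+ 2 *: direction (p i) x.

Lemma dot_suml (R : realType) (n k : nat) (f : 'I_k -> 'rV[R]_n) (v : 'rV[R]_n) :
  dot (\sum_(i < k) f i) v = \sum_(i < k) dot (f i) v.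
Proof.
rewrite /dot exchange_big; apply: eq_bigr => j _.
by rewrite summxE mulr_suml.
Qed.

Lemma is_derive_potential (R : realType) (V : normedModType R) (k : nat) (m : R)
    (p : 'I_k -> 'rV[R]_3) (f : V -> 'rV[R]_3) (x v : V) (df : 'rV[R]_3) :
  is_derive x v f df -> punctured_space p (f x) ->
  is_derive x v (fun y => potential m p (f y) : R^o)
    (dot (grad_potential p (f x)) df).
Proof.
move=> fdf px.
rewrite [X in is_derive _ _ X](_ : _ =
    cst m + \sum_(i < k) (fun y => (2 * enorm (f y - p i))^-1 : R^o)); last first.
  by rewrite funeqE => y; rewrite /= /potential fctE fct_sumE.
have fp0 i : enorm (f x - p i) != 0.
  by rewrite gt_eqF// enorm_gt0// subr_eq0; apply/eqP/px.
have termP i : is_derive x v (fun y => (2 * enorm (f y - p i))^-1 : R^o)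
    (- (2 * enorm (f x - p i)) ^- 2 *
       (2 * (dot (f x - p i) df / enorm (f x - p i)))).
  set g := fun y => 2 * enorm (f y - p i) : R^o.
  have [dg gE] : is_derive x v g (2 * (dot (f x - p i) df / enorm (f x - p i))).
    apply: (@is_deriveZ _ _ R^o _ 2); apply: is_derive_enorm.
      exact: is_deriveBcst.
    by apply: contraNneq (fp0 i) => ->; rewrite /enorm dot0l sqrtr0.
  have gx0 : g x != 0 by rewrite mulf_neq0.
  by split; [exact: derivableV|rewrite deriveV// gE].
apply: (is_derive_eq (is_deriveD (is_derive_cst (m : R^o) x v) (is_derive_sum termP))).
rewrite add0r dotZl dot_suml mulr_sumr; apply: eq_bigr => i _.
by rewrite !dotZl; field; exact: fp0.
Qed.

Lemma star_dpotentialE (R : realType) (k : nat) (m : R)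
    (p : 'I_k -> 'rV[R]_3) (x u v : 'rV[R]_3) :
  punctured_space p x ->
  star_dpotential m p x u v = det3 (grad_potential p x) u v.
Proof.
move=> px; rewrite /star_dpotential (_ : \row_l _ = grad_potential p x)//.
apply/rowP => l; rewrite mxE.
have [_ E] := is_derive_potential m (is_derive_id x (delta_mx 0 l)) px.
rewrite /partial [LHS]E.
rewrite /dot (bigD1 l)//= big1 => [|i il].
  by rewrite [delta_mx _ _ _ _]mxE !eqxx mulr1 addr0.
by rewrite [delta_mx _ _ _ _]mxE (negbTE il) mulr0.
Qed.

(** The differentiated quotient is the first derivative of |f|. The result is the Hessian of the
    norm on the velocity, which sees only the part orthogonal to f, plus the unit vector paired with
    the acceleration. *)
Lemma is_derive_dot_over_enorm (R : realType) (f df : R -> 'rV[R]_3) (t : R)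
    (d2f : 'rV[R]_3) :
  is_derive t 1 f (df t) -> is_derive t 1 df d2f -> f t != 0 ->
  is_derive t 1 (fun s => dot (f s) (df s) / enorm (f s) : R^o)
   ((enorm (f t))^-1 * (dot (df t) (df t)
        - dot ((enorm (f t))^-1 *: f t) (df t) ^+ 2)
     + dot ((enorm (f t))^-1 *: f t) d2f).
Proof.
move=> fdf dfd2 ft0; have r0 := enorm_gt0 ft0.
have [dn nE] := is_derive_enorm fdf ft0.
have V : is_derive t 1 (fun s => (enorm (f s))^-1 : R^o)
    (- (enorm (f t)) ^- 2 *: (dot (f t) (df t) / enorm (f t))).
  by split; [apply: derivableV => //; rewrite gt_eqF|rewrite deriveV ?nE// gt_eqF].
apply: is_derive_eq; first exact: (is_deriveM (is_derive_dot fdf dfd2) V).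
by rewrite /GRing.scale /= !dotZl; field; rewrite gt_eqF.
Qed.

(** * The Gibbons-Hawking metric in a trivializing chart *)

(** In a chart given by a local trivialization, the first three coordinates are the base point and
    the fourth is the angle. *)
Definition spatial (R : realType) (y : 'rV[R]_4) : 'rV[R]_3 :=
  @lsubmx R 1 3 1 y.

Lemma spatialE (R : realType) (y : 'rV[R]_4) i :
  spatial y 0 i = y 0 (@lshift 3 1 i).
Proof. by rewrite mxE. Qed.

Lemma is_derive_spatial (R : realType) (V : normedModType R) (f : V -> 'rV[R]_4)
    (x v : V) (df : 'rV[R]_4) :
  is_derive x v f df -> is_derive x v (fun y => spatial (f y)) (spatial df).
Proof.
move=> fdf.
have D i : is_derive x v (fun y => spatial (f y) 0 i : R^o) (spatial df 0 i).
  under eq_fun do rewrite spatialE.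
  by rewrite spatialE; exact: is_derive_entry.
have d : derivable (fun y => spatial (f y)) x v.
  by apply/derivable_mxP => i j; rewrite ord1; have [] := D j.
split=> //; rewrite derive_mx//; apply/rowP => i; rewrite mxE.
by have [] := D i.
Qed.

Lemma derivable_ev1 (R : realType) (X : manifold R 4)
    (eta : chart R X 4 -> 'rV[R]_4 -> 'cV[R]_4) (c : chart R X 4)
    (w x v : 'rV[R]_4) :
  differentiable (eta c) x -> derivable (ev1 eta c w : _ -> R^o) x v.
Proof.
move=> /diff_derivable - /(_ v) /derivable_mxP d.
rewrite (_ : ev1 eta c w = \sum_(i < 4) (w 0 i \*: (fun y => eta c y i 0 : R^o))).
  by apply: derivable_sum => i; exact: derivableZ.
by rewrite funeqE => y; rewrite fct_sumE /ev1 mxE.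
Qed.

(** In such charts the projection is linear, so it adds no second order terms to F, and the centers
    are avoided. *)
Definition trivialized (R : realType) (k : nat) (m : R) (p : 'I_k -> 'rV[R]_3)
    (X : gibbons_hawking m p) (c : chart R X 4) : Prop :=
  forall x, ccod c x ->
    gh_proj (cinv c x) = spatial x /\ punctured_space p (spatial x).

Lemma nbhs_ccod (R : realType) (n : nat) (M : manifold R n) (c : chart R M n)
    (x : 'rV[R]_n) : atlas c -> ccod c x -> nbhs x (ccod c).
Proof. by move=> /atlas_chart [[_ oc] _ _ _ _] cx; exact: open_nbhs_nbhs. Qed.

Lemma derive_gh_proj (R : realType) (k : nat) (m : R) (p : 'I_k -> 'rV[R]_3)
    (X : gibbons_hawking m p) (c : chart R X 4) (x u : 'rV[R]_4) :
  atlas c -> trivialized c -> ccod c x ->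
  'D_u (@gh_proj R k m p X \o cinv c) x = spatial u.
Proof.
move=> ac tc cx; have [_ <-] := is_derive_spatial (is_derive_id x u).
apply: near_eq_derive; near=> y.
by rewrite /= (tc y _).1//; near: y; exact: nbhs_ccod.
Unshelve. all: by end_near. Qed.

Lemma bil_gh_metric (R : realType) (k : nat) (m : R) (p : 'I_k -> 'rV[R]_3)
    (X : gibbons_hawking m p) (c : chart R X 4) (x u w : 'rV[R]_4) :
  atlas c -> trivialized c -> ccod c x ->
  bil (gh_metric c x) u w =
    (potential m p (spatial x))^-1 *
      (ev1 (@gh_conn R k m p X) c u x * ev1 (@gh_conn R k m p X) c w x)
    + potential m p (spatial x) * dot (spatial u) (spatial w).
Proof.
move=> ac tc cx.
have [tcE px] := tc x cx.
by rewrite gh_metricE ?tcE// !derive_gh_proj.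
Qed.

(** The derivatives of the connection form stay unevaluated here; only their antisymmetric
    combination is known. *)
Lemma derive_gh_metric (R : realType) (k : nat) (m : R) (p : 'I_k -> 'rV[R]_3)
    (X : gibbons_hawking m p) (c : chart R X 4) (y u w z : 'rV[R]_4) :
  atlas c -> trivialized c -> ccod c y ->
  let phi := potential m p (spatial y) in
  let dphi := dot (grad_potential p (spatial y)) (spatial z) in
  let eta u := ev1 (@gh_conn R k m p X) c u in
  let deta u := 'D_z (eta u : _ -> R^o) y in
  phi != 0 ->
  'D_z (fun x => bil (gh_metric c x) u w : R^o) y =
    phi^-1 * (eta u y * deta w + eta w y * deta u)
    - phi ^- 2 * dphi * (eta u y * eta w y)
    + dphi * dot (spatial u) (spatial w).
Proof.
move=> ac tc cy phi dphi eta deta phi0.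
have [tcE py] := tc y cy.
have deta_c : differentiable (@gh_conn R k m p X c) y.
  have [sm _ _] := @gh_connP R k m p X.
  by apply: (sm c ac [::] y); split=> //=; rewrite tcE.
have E u' : is_derive y z (eta u' : _ -> R^o) (deta u').
  by apply/derivableP; exact: derivable_ev1.
have P := is_derive_potential m (is_derive_spatial (is_derive_id y z)) py.
have V : is_derive y z (fun x => (potential m p (spatial x))^-1 : R^o)
    (- phi ^- 2 * dphi).
  case: P => dP PE; split; first exact: derivableV.
  by rewrite deriveV// PE.
pose rhs : 'rV[R]_4 -> R^o := fun x =>
   (potential m p (spatial x))^-1 * (eta u x * eta w x)
   + potential m p (spatial x) * dot (spatial u) (spatial w).
rewrite (near_eq_derive (g := rhs)); last first.
  by near=> x; rewrite bil_gh_metric//; near: x; exact: nbhs_ccod.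
have [_ ->] := is_deriveD (is_deriveM V (is_deriveM (E u) (E w)))
   (is_deriveM P (is_derive_cst (dot (spatial u) (spatial w) : R^o) y z)).
rewrite /GRing.scale /= -/phi -/dphi.
rewrite -[(eta u * eta w) y]/(eta u y * eta w y).
move: (eta u y) (eta w y) (deta u : R) (deta w : R) => a1 a2 a3 a4; ring.
Unshelve. all: by end_near. Qed.

Lemma potential2E (R : realType) (m : R) (p : 'I_2 -> 'rV[R]_3) (x : 'rV[R]_3) :
  potential m p x =
  m + ((enorm (x - p ord0))^-1 + (enorm (x - p ord_max))^-1) / 2.
Proof.
rewrite /potential big_ord_recr big_ord1 /= !invfM.
rewrite [widen_ord _ _](_ : _ = ord0); last exact/val_inj.
by move: (enorm _)^-1 (enorm _)^-1 => s t; field.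
Qed.

Lemma grad_potential2E (R : realType) (p : 'I_2 -> 'rV[R]_3) (x : 'rV[R]_3) :
  grad_potential p x =
  - 2^-1 *: ((enorm (x - p ord0))^-1 ^+ 2 *: direction (p ord0) x
           + (enorm (x - p ord_max))^-1 ^+ 2 *: direction (p ord_max) x).
Proof.
rewrite /grad_potential big_ord_recr big_ord1 /=.
by rewrite [widen_ord _ _](_ : _ = ord0)//; exact/val_inj.
Qed.

Lemma dot_direction (R : realType) (n : nat) (p x : 'rV[R]_n) :
  x != p -> dot (direction p x) (direction p x) = 1.
Proof.
rewrite -subr_eq0 => /enorm_gt0 r0; rewrite dotZl dotZr -sqr_enorm; field.
by rewrite gt_eqF.
Qed.

Lemma spatial_row_mx (R : realType) (x : 'rV[R]_3) (t : R) :
  spatial (row_mx x t%:M : 'rV[R]_(3 + 1)) = x.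
Proof. exact: row_mxKl. Qed.

(* The differential of |x - p_1| + |x - p_2| at x, pulled back by spatial. *)
Definition dist_sum_covector (R : realType) (p : 'I_2 -> 'rV[R]_3)
    (x : 'rV[R]_3) : 'rV[R]_4 :=
  row_mx (direction (p ord0) x + direction (p ord_max) x) (0 : R)%:M.

Lemma dot_dist_sum_covector (R : realType) (p : 'I_2 -> 'rV[R]_3)
    (x : 'rV[R]_3) (v : 'rV[R]_4) :
  dot (dist_sum_covector p x) v =
  dot (direction (p ord0) x + direction (p ord_max) x) (spatial v).
Proof.
rewrite /dot (@big_split_ord _ _ _ 3 1) /= big_ord1.
rewrite [X in _ + X](_ : _ = 0) ?addr0; last first.
  by rewrite (@row_mxEr _ 1 3 1) mxE eqxx mul0r.
by apply: eq_bigr => i _; rewrite (@row_mxEl _ 1 3 1) spatialE.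
Qed.

(** The right-hand side is the Euclidean Hessian of F in the chart, so the inequality is positivity
    of the covariant Hessian at [v]. The vector [W] is the gradient of F, identified by testing the
    metric on suitable vectors. *)
Lemma gh_hessian_gt0 (R : realType) (m : R) (p : 'I_2 -> 'rV[R]_3)
    (X : gibbons_hawking m p) (c : chart R X 4) (y v : 'rV[R]_4)
    (x := spatial y) (a := direction (p ord0) x) (b := direction (p ord_max) x) :
  0 <= m -> atlas c -> trivialized c -> ccod c y -> a + b != 0 -> v != 0 ->
  \sum_(i < 4) dist_sum_covector p x 0 i *
    (\sum_(j < 4) \sum_(l < 4) christoffel (gh_metric c) y i j l * v 0 j * v 0 l)
  < (enorm (x - p ord0))^-1 *
      (dot (spatial v) (spatial v) - dot a (spatial v) ^+ 2)
  + (enorm (x - p ord_max))^-1 *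
      (dot (spatial v) (spatial v) - dot b (spatial v) ^+ 2).
Proof.
move=> m0 ac tc cy ab0 v0.
have [smooth_g symg posg _] := @gh_metricP R 2 m p X.
have [pE px] := tc y cy.
rewrite christoffel_contraction; last exact: (smooth_g c ac [::] y cy).
set omega := dist_sum_covector p x; set W := omega *m _.
have x0 i : x != p i by apply/eqP/px.
have r0 i : 0 < enorm (x - p i) by rewrite enorm_gt0// subr_eq0.
set s := (enorm (x - p ord0))^-1; set t := (enorm (x - p ord_max))^-1.
have s0 : 0 < s by rewrite invr_gt0.
have t0 : 0 < t by rewrite invr_gt0.
set phi := potential m p x.
have phiE : phi = m + (s + t) / 2 by exact: potential2E.
have phi0 : 0 < phi by rewrite phiE ltr_wpDl// divr_gt0// addr_gt0.
have phi_neq0 : phi != 0 by rewrite gt_eqF.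
pose eta u := ev1 (@gh_conn R 2 m p X) c u y.
have gE u w : bil (gh_metric c y) u w =
    phi^-1 * (eta u * eta w) + phi * dot (spatial u) (spatial w).
  by rewrite bil_gh_metric.
have gW u : phi^-1 * (eta W * eta u) + phi * dot (spatial W) (spatial u) =
    dot (a + b) (spatial u).
  rewrite -gE -dot_dist_sum_covector -/omega /bil /W mulmxKV.
    by rewrite [LHS]mxE; apply: eq_bigr => i _; rewrite [u^T _ _]mxE.
  by apply: posdef_unitmx => w w0; exact: posg.
(* Otherwise the metric would vanish on a nonzero vertical vector. *)
have eta_neq0 u : u != 0 -> spatial u = 0 -> eta u != 0.
  move=> u0 uE; have := posg c y u ac cy u0.
  rewrite gE uE dot0l mulr0 addr0; apply: contraTneq => ->.
  by rewrite mul0r mulr0 ltxx.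
(* dF kills the vertical vector [e], so [W] is orthogonal to it, while [eta e] is nonzero. *)
have etaW : eta W = 0.
  pose e : 'rV[R]_4 := row_mx (0 : 'rV[R]_3) (1 : R)%:M.
  have eE : spatial e = 0 by exact: row_mxKl.
  have e0 : e != 0.
    apply/eqP => /rowP /(_ (@rshift 3 1 0)) /eqP.
    by rewrite (@row_mxEr _ 1 3 1) !mxE oner_eq0.
  have := gW e; rewrite eE ![dot _ 0]dotC !dot0l mulr0 addr0 => /eqP.
  rewrite !mulf_eq0 invr_eq0 (negbTE phi_neq0) (negbTE (eta_neq0 e e0 eE)) orbF.
  by move=> /eqP.
(* Testing [gW] on a vector with spatial part [z] gives [dot z z = 0]. *)
have WE : spatial W = phi^-1 *: (a + b).
  apply/eqP; rewrite -subr_eq0; apply/eqP/dot_eq0.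
  set z := _ - _; pose u : 'rV[R]_4 := row_mx z (0 : R)%:M.
  have uz : spatial u = z by exact: row_mxKl.
  have := gW u; rewrite etaW mul0r mulr0 add0r uz => E.
  rewrite {1}/z -scaleN1r scalerA dotDl dotZl -E; field.
  by rewrite phi_neq0.
rewrite !derive_gh_metric//.
rewrite -/(eta W) -/(eta v) etaW.
have := @gh_curvature R 2 m p X c y v W ac cy.
rewrite pE => /(_ px); rewrite !derive_gh_proj// star_dpotentialE//.
have -> : det3 (grad_potential p (spatial y)) (spatial v) (spatial W) =
    phi^-1 * det3 (grad_potential p x) (spatial v) (a + b).
  by rewrite WE det3Zr.
have -> : dot (grad_potential p (spatial y)) (spatial W) =
    phi^-1 * dot (grad_potential p x) (a + b) by rewrite WE dotZr.
have -> : dot (spatial W) (spatial v) = phi^-1 * dot (a + b) (spatial v).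
  by rewrite WE dotZl.
(* The curvature equation trades the derivative of [eta W] along [v] for that of [eta v] along [W],
   which then cancels against the second Koszul term. *)
rewrite /ext_deriv -/phi => /eqP; rewrite subr_eq => /eqP ->.
(* [phi^-1 * eta v] is the vertical coordinate [tau] of [two_center_form_gt0]. *)
have vtau : spatial v = 0 -> phi^-1 * eta v != 0.
  by move=> vE; rewrite mulf_neq0 ?invr_eq0// eta_neq0.
have := two_center_form_gt0 (dot_direction (x0 ord0)) (dot_direction (x0 ord_max))
  ab0 m0 s0 t0 vtau.
rewrite -grad_potential2E -phiE -/a -/b => H.
rewrite -subr_gt0 -(pmulr_rgt0 _ phi0); apply: (lt_le_trans H).
rewrite le_eqVlt; apply/orP; left; apply/eqP.
move: (dot _ _) (dot _ _) (dot _ _) (dot _ _) (dot _ _) (det3 _ _ _).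
move: ('D_W _ _ : R) (eta v) (dot _ _) => d1 d2 d3 d4 d5 d6 d7 d8 d9.
by field.
Qed.

(** * The sum of distances and the segment *)

Lemma enormZ (R : realType) (n : nat) (k : R) (x : 'rV[R]_n) :
  enorm (k *: x) = `|k| * enorm x.
Proof.
by rewrite /enorm dotZl dotZr mulrA -expr2 sqrtrM ?sqr_ge0// sqrtr_sqr.
Qed.

Lemma enorm_eq0 (R : realType) (n : nat) (x : 'rV[R]_n) : enorm x = 0 -> x = 0.
Proof.
move=> r0; apply/eqP/negPn/negP => /enorm_gt0; by rewrite r0 ltxx.
Qed.

(** The relation makes [x] the barycenter of [a] and [b] with weights [s] and [t]. The weights are
    inverse distances at a critical point of F, and the exchanged distances where F is minimal. *)
Lemma segment_weighted (R : realType) (n : nat) (a b x : 'rV[R]_n) (s t : R) :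
  0 <= s -> 0 <= t -> 0 < s + t -> s *: (x - a) + t *: (x - b) = 0 ->
  segment a b x.
Proof.
move=> s0 t0 st0 E; exists (t / (s + t)); split.
  by rewrite divr_ge0 ?(ltW st0)//= ler_pdivrMr// mul1r lerDr.
apply: (scalerI (lt0r_neq0 st0)); rewrite scalerDr !scalerA.
rewrite mulrBr mulr1 mulrC divfK ?gt_eqF// addrK.
apply/eqP; rewrite -subr_eq0; apply/eqP; rewrite -E.
by rewrite !scalerBr scalerDl; apply/rowP => i; rewrite !mxE; ring.
Qed.

Definition dist_sum (R : realType) (n : nat) (p : 'I_2 -> 'rV[R]_n)
    (x : 'rV[R]_n) : R :=
  enorm (x - p ord0) + enorm (x - p ord_max).

Lemma dist_sum_segment (R : realType) (n : nat) (p : 'I_2 -> 'rV[R]_n)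
    (x : 'rV[R]_n) :
  segment (p ord0) (p ord_max) x -> dist_sum p x = enorm (p ord0 - p ord_max).
Proof.
move=> [t [/andP[t0 t1] ->]]; rewrite /dist_sum.
rewrite (_ : _ - p ord0 = (- t) *: (p ord0 - p ord_max)); last first.
  by apply/rowP => i; rewrite !mxE; ring.
rewrite (_ : _ + _ - p ord_max = (1 - t) *: (p ord0 - p ord_max)); last first.
  by apply/rowP => i; rewrite !mxE; ring.
by rewrite !enormZ normrN !ger0_norm ?subr_ge0// -mulrDl addrC subrK mul1r.
Qed.

(** Equality in the triangle inequality: [y] and [z] point in opposite directions. Avoiding division
    by the norms keeps zero vectors, and thus the centers, included. *)
Lemma enormB_opposite (R : realType) (n : nat) (y z : 'rV[R]_n) :
  enorm y + enorm z <= enorm (z - y) -> enorm z *: y + enorm y *: z = 0.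
Proof.
move=> yz; apply: dot_eq0; apply/eqP; rewrite eq_le dot_ge0 andbT.
have : (enorm y + enorm z) ^+ 2 <= dot (z - y) (z - y).
  by rewrite -sqr_enorm ler_sqr ?nnegrE ?addr_ge0 ?enorm_ge0.
rewrite -(scaleN1r y) !dotDl !dotDr !dotZl !dotZr -!sqr_enorm [dot z y]dotC.
move: (enorm_ge0 y) (enorm_ge0 z).
move: (enorm y) (enorm z) (dot y z) => r q d r0 q0 H.
have Hd : d + r * q <= 0 by move: H; rewrite expr2; lra.
have rq0 : 0 <= r * q by rewrite mulr_ge0.
rewrite [X in X <= 0](_ : _ = 2 * ((r * q) * (d + r * q))); last by ring.
by rewrite pmulr_rle0// mulr_ge0_le0.
Qed.

Lemma segment_dist_sum (R : realType) (n : nat) (p : 'I_2 -> 'rV[R]_n)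
    (x : 'rV[R]_n) :
  p ord0 != p ord_max -> dist_sum p x <= enorm (p ord0 - p ord_max) ->
  segment (p ord0) (p ord_max) x.
Proof.
rewrite /dist_sum => p01.
have -> : p ord0 - p ord_max = (x - p ord_max) - (x - p ord0).
  by apply/rowP => i; rewrite !mxE; ring.
move=> /enormB_opposite.
apply: segment_weighted; rewrite ?enorm_ge0//.
(* Both weights vanish only if [x] equals both centers. *)
rewrite lt_neqAle addr_ge0 ?enorm_ge0// andbT eq_sym.
apply: contraNneq p01 => /eqP; rewrite paddr_eq0 ?enorm_ge0//.
move=> /andP[/eqP/enorm_eq0/eqP + /eqP/enorm_eq0/eqP].
by rewrite !subr_eq0 => /eqP <- /eqP <-.
Qed.

Lemma segment_direction (R : realType) (n : nat) (p : 'I_2 -> 'rV[R]_n)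
    (x : 'rV[R]_n) : x != p ord0 -> x != p ord_max ->
  direction (p ord0) x + direction (p ord_max) x = 0 ->
  segment (p ord0) (p ord_max) x.
Proof.
rewrite -![x == _]subr_eq0 => /enorm_gt0 r0 /enorm_gt0 q0 E.
apply: (@segment_weighted _ _ _ _ _ (enorm (x - p ord0))^-1
  (enorm (x - p ord_max))^-1) => //; rewrite ?invr_ge0 ?enorm_ge0//.
by rewrite addr_gt0 ?invr_gt0.
Qed.

(** The existence of a maximum needs continuity at the centers too, where the distance is not
    differentiable; hence the detour through squared distances. *)
Lemma dist_sum_continuous (R : realType) (n : nat) (p : 'I_2 -> 'rV[R]_n) :
  continuous (dist_sum p).
Proof.
have D q : continuous (fun x : 'rV[R]_n => dot (x - q) (x - q)).
  move=> x; have -> : (fun x : 'rV[R]_n => dot (x - q) (x - q)) =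
     \sum_(i < n) (fun x : 'rV[R]_n => (x - q) 0 i * (x - q) 0 i).
    by rewrite funeqE => y; rewrite fct_sumE.
  apply: differentiable_continuous; apply: differentiable_sum => i.
  have dx : differentiable (fun x : 'rV[R]_n => (x - q) 0 i : R^o) x.
    apply: (@differentiable_comp _ _ _ R^o (fun x => x - q)
      (fun x : 'rV[R]_n => x 0 i : R^o)); last exact: differentiable_coord.
    by apply: differentiableB; [exact: ex_diff|exact: differentiable_cst].
  exact: (differentiableM dx dx).
have C q : continuous (fun x : 'rV[R]_n => enorm (x - q)).
  move=> x; apply: (@continuous_comp _ _ _ _ (@Num.sqrt R) x (D q x)).
  exact: sqrt_continuous.
by move=> x; exact: (cvgD (C _ x) (C _ x)).
Qed.

(** * Immersions with vanishing mean curvature *)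

Lemma derive_sum_delta (R : realType) (d : nat) (W : normedModType R)
    (f : 'rV[R]_d -> W) (u w : 'rV[R]_d) :
  differentiable f u ->
  'D_w f u = \sum_(j < d) w 0 j *: 'D_(delta_mx 0 j) f u.
Proof.
move=> df; rewrite deriveE// [in LHS](row_sum_delta w) linear_sum.
by apply: eq_bigr => j _; rewrite linearZ deriveE.
Qed.

Lemma partial_fcomp (R : realType) (d n : nat) (f : 'rV[R]_d -> 'rV[R]_n)
    (u : 'rV[R]_d) (j : 'I_d) (a : 'I_n) :
  differentiable f u ->
  partial j (fcomp f a) u = 'D_(delta_mx 0 j) f u 0 a.
Proof.
move=> /diff_derivable - /(_ (delta_mx 0 j)) df.
by have [_ <-] := is_derive_entry 0 a (derivableP df).
Qed.

Lemma tangentE (R : realType) (d n : nat) (f : 'rV[R]_d -> 'rV[R]_n)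
    (u : 'rV[R]_d) (j : 'I_d) :
  differentiable f u -> tangent f j u = 'D_(delta_mx 0 j) f u.
Proof. by move=> df; apply/rowP => a; rewrite mxE partial_fcomp. Qed.

(** Links the coordinate partials in [covariant_hessian] to the second derivative along a line,
    which is what a maximum controls. *)
Lemma second_derive_partial (R : realType) (d n : nat)
    (f : 'rV[R]_d -> 'rV[R]_n) (u w : 'rV[R]_d) (a : 'I_n) :
  (\forall u' \near u, differentiable f u') ->
  (forall v, differentiable ('D_v f) u) ->
  'D_w ('D_w f) u 0 a =
  \sum_(i < d) \sum_(j < d) w 0 i * w 0 j * partial i (partial j (fcomp f a)) u.
Proof.
move=> df d2f.
have e2f v : differentiable (fun u' => 'D_v f u' 0 a : R^o) u.
  exact: (@differentiable_comp _ _ _ R^o _ (fun x : 'rV[R]_n => x 0 a : R^o) _ (d2f v)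
    (differentiable_coord _ _ _)).
have [_ <-] := is_derive_entry 0 a (derivableP (diff_derivable (v := w) (d2f w))).
(* ['D_w f] agrees with this combination on a neighborhood of [u], so the two can be differentiated
   once more. *)
pose h : 'rV[R]_d -> R^o :=
  \sum_(j < d) (w 0 j \*: (fun u' => 'D_(delta_mx 0 j) f u' 0 a : R^o)).
rewrite (near_eq_derive (g := h)); last first.
  near=> u'; rewrite derive_sum_delta; last by near: u'.
  by rewrite summxE /h fct_sumE; apply: eq_bigr => j _; rewrite mxE.
rewrite derive_sum; last first.
  by move=> j; apply: derivableZ; apply: diff_derivable.
rewrite exchange_big; apply: eq_bigr => j _ /=.
rewrite deriveZ; last exact: diff_derivable.
rewrite derive_sum_delta// scaler_sumr; apply: eq_bigr => i _.
rewrite /GRing.scale /= mulrA [w 0 j * _]mulrC; congr (_ * _).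
apply: near_eq_derive; near=> u'.
by rewrite partial_fcomp//; near: u'.
Unshelve. all: by end_near. Qed.

Lemma induced_metricE (R : realType) (d n : nat) (g : 'rV[R]_n -> 'M[R]_n)
    (f : 'rV[R]_d -> 'rV[R]_n) (u : 'rV[R]_d)
    (T := \matrix_(i < d) tangent f i u) :
  induced_metric g f u = T *m g (f u) *m T^T.
Proof.
apply/matrixP => i j; rewrite mxE /bil.
rewrite -[tangent f i u](rowK (fun i => tangent f i u)).
rewrite -[tangent f j u](rowK (fun i => tangent f i u)).
rewrite -row_mul [LHS]mxE [RHS]mxE; apply: eq_bigr => k _.
by congr (_ * _); [rewrite mxE|rewrite !mxE].
Qed.

(* If omega = dF kills the tangent space, it kills the trace H of the covariant
   Hessian of f, which is tangent when its normal part vanishes.  Writing the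
   inverse induced metric as B^T B turns omega(H) into the sum of the values of a
   quadratic form on the rows of B, which therefore cannot all be negative. *)
Lemma mean_curvature0_direction (R : realType) (d n : nat)
    (g : 'rV[R]_n -> 'M[R]_n) (f : 'rV[R]_d.+1 -> 'rV[R]_n)
    (u : 'rV[R]_d.+1) (omega : 'rV[R]_n) :
  (\forall u' \near u, differentiable f u') ->
  (forall v, differentiable ('D_v f) u) ->
  (g (f u))^T = g (f u) -> (forall v, v != 0 -> 0 < bil (g (f u)) v v) ->
  (forall v, 'D_v f u = 0 -> v = 0) ->
  (forall v, dot omega ('D_v f u) = 0) ->
  mean_curvature g f u = 0 ->
  exists2 w, w != 0 &
    0 <= dot omega ('D_w ('D_w f) u) +
      \sum_(a < n) omega 0 a * (\sum_(b < n) \sum_(c < n)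
        christoffel g (f u) a b c * 'D_w f u 0 b * 'D_w f u 0 c).
Proof.
move=> df d2f symg posg immf critf mc0.
have dfu : differentiable f u by exact: nbhs_singleton df.
pose T := \matrix_(i < d.+1) tangent f i u.
have TE w : 'D_w f u = w *m T.
  rewrite derive_sum_delta// mulmx_sum_row; apply: eq_bigr => i _.
  by rewrite rowK tangentE.
have [||B BE B0] := @posdef_invmx_cholesky R d (induced_metric g f u).
- by rewrite induced_metricE !trmx_mul trmxK symg mulmxA.
- move=> v v0; rewrite induced_metricE /bil !mulmxA -mulmxA -trmx_mul -TE.
  by apply: posg; apply: contraNneq v0 => /immf ->.
pose H := \sum_(i < d.+1) \sum_(j < d.+1)
  invmx (induced_metric g f u) i j *: covariant_hessian g f u i j.
have H0 : dot omega H = 0.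
  move: mc0; rewrite /mean_curvature /normal_part -/H => /eqP.
  rewrite subr_eq0 => /eqP ->; rewrite dotC dot_suml big1// => k _.
  rewrite dot_suml big1// => l _.
  by rewrite dotZl dotC [tangent _ l _]tangentE// critf mulr0.
pose Q w := dot omega ('D_w ('D_w f) u) +
      \sum_(a < n) omega 0 a * (\sum_(b < n) \sum_(c < n)
        christoffel g (f u) a b c * 'D_w f u 0 b * 'D_w f u 0 c).
have QE w : Q w = dot omega
    (\sum_(i < d.+1) \sum_(j < d.+1) (w 0 i * w 0 j) *: covariant_hessian g f u i j).
  rewrite /Q /dot -big_split; apply: eq_bigr => a _ /=; rewrite -mulrDr; congr (_ * _).
  rewrite second_derive_partial// summxE.
  under [RHS]eq_bigr do rewrite summxE.
  under [RHS]eq_bigr do under eq_bigr do rewrite !mxE mulrDr.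
  under [RHS]eq_bigr do rewrite big_split.
  rewrite big_split; congr (_ + _).
  have DE b : 'D_w f u 0 b = \sum_(i < d.+1) w 0 i * partial i (fcomp f b) u.
    by rewrite TE mxE; apply: eq_bigr => i _; rewrite !mxE.
  transitivity (\sum_(b < n) \sum_(c < n) \sum_(i < d.+1) \sum_(j < d.+1)
     w 0 i * w 0 j * (christoffel g (f u) a b c * partial i (fcomp f b) u
        * partial j (fcomp f c) u)).
    apply: eq_bigr => b _; apply: eq_bigr => c _; rewrite !DE -mulrA big_distrlr /=.
    rewrite mulr_sumr; apply: eq_bigr => i _; rewrite mulr_sumr; apply: eq_bigr => j _.
    by ring.
  rewrite (eq_bigr _ (fun b _ => exchange_big _ _ _ _ _ _)) /=.
  rewrite exchange_big; apply: eq_bigr => i _.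
  rewrite (eq_bigr _ (fun b _ => exchange_big _ _ _ _ _ _)) /=.
  rewrite exchange_big; apply: eq_bigr => j _.
  by rewrite mulr_sumr; apply: eq_bigr => b _; rewrite mulr_sumr.
have HE : H = \sum_(k < d.+1) \sum_(i < d.+1) \sum_(j < d.+1)
     (row k B 0 i * row k B 0 j) *: covariant_hessian g f u i j.
  rewrite [RHS]exchange_big /H; apply: eq_bigr => i _.
  rewrite [RHS]exchange_big; apply: eq_bigr => j _.
  rewrite BE [X in X *: _]mxE scaler_suml; apply: eq_bigr => k _.
  by rewrite [B^T _ _]mxE ![row _ _ _ _]mxE.
have QB : \sum_(k < d.+1) Q (row k B) = 0.
  transitivity (dot omega H); last exact: H0.
  rewrite HE dotC dot_suml; apply: eq_bigr => k _; rewrite dotC; exact: QE.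
have [k Bk0] : exists k, row k B != 0.
  apply/existsP; rewrite -negb_forall; apply: contra B0 => /forallP B0.
  by apply/eqP/row_matrixP => k; rewrite row0; apply/eqP.
have [[w [w0 Qw]]|nQ] := pselect (exists w, w != 0 /\ 0 <= Q w).
  by exists w.
have Qneg w : w != 0 -> Q w < 0.
  by move=> w0; rewrite ltNge; apply/negP => Qw; apply: nQ; exists w.
(* Some rows of [B] may be zero, hence the nonstrict bound for them. *)
have Qle w : Q w <= 0.
  have [->|/Qneg/ltW//] := eqVneq w 0.
  have z0 i j : (0 : 'rV[R]_d.+1) 0 i * (0 : 'rV[R]_d.+1) 0 j = 0.
    by rewrite mxE mul0r.
  rewrite QE dotC.
  under eq_bigr do under eq_bigr do rewrite z0 scale0r.
  under eq_bigr do rewrite sumr_const mul0rn.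
  by rewrite sumr_const mul0rn dot0l.
have := Qneg _ Bk0; rewrite -[X in _ < X]QB (bigD1 k)//= => /lt_geF/negP[].
by rewrite gerDl sumr_le0.
Qed.

(** * The maximum principle *)

Lemma nbhs_coord_dom (R : realType) (d n : nat) (S : manifold R d)
    (M : manifold R n) (f : S -> M) (c : chart R S d) (c' : chart R M n) u :
  continuous f -> atlas c -> atlas c' -> coord_dom f c c' u ->
  nbhs u (coord_dom f c c').
Proof.
move=> cf ac ac' [cu c'u].
have [_ _ _ _ /(_ u cu) cinvc] := atlas_chart ac.
have [[oc' _] _ _ _ _] := atlas_chart ac'.
have : nbhs u (ccod c `&` (f \o cinv c) @^-1` cdom c') => //.
apply: filterI; first exact: nbhs_ccod.
have cfc : {for u, continuous (f \o cinv c)} by exact: (continuous_comp cinvc (cf _)).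
by apply: cfc; exact: open_nbhs_nbhs.
Qed.

(** The chart is the strip of a local trivialization centered at the angle of [q]. *)
Lemma trivialization_chart (R : realType) (k : nat) (m : R)
    (p : 'I_k -> 'rV[R]_3) (X : gibbons_hawking m p) (q : X) :
  punctured_space p (gh_proj q) ->
  exists c : chart R X 4, [/\ atlas c, trivialized c & cdom c q].
Proof.
move=> pq; have [V [Phi [oV Vq Vp [projPhi _ _ surj charts]]]] :=
  @gh_bundle R k m p X _ pq.
have [t qE] := surj q Vq.
have [c [ac ccodE cinvE]] := charts t.
have [_ _ cc _ _] := atlas_chart ac.
exists c; split=> //.
- move=> y; rewrite ccodE => -[x [s [Vx st ->]]].
  rewrite cinvE// projPhi// spatial_row_mx; split=> //; exact: Vp.
- rewrite qE -cinvE ?subrr ?normr0 ?pi_gt0//; apply: (cc _ _).1.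
  by rewrite ccodE; exists (gh_proj q), t; split; rewrite ?subrr ?normr0 ?pi_gt0.
Qed.

(** The second derivative test along the line through [u] in direction [w]. The second derivative of
    F splits into its Euclidean Hessian on the velocity and dF on the acceleration. *)
Lemma dist_sum_second_derivative (R : realType) (d : nat) (p : 'I_2 -> 'rV[R]_3)
    (f : 'rV[R]_d -> 'rV[R]_4) (u w : 'rV[R]_d)
    (x := spatial (f u)) (v := spatial ('D_w f u)) :
  (\forall u' \near u, differentiable f u') ->
  differentiable ('D_w f) u ->
  (\forall u' \near u, punctured_space p (spatial (f u'))) ->
  (\forall u' \near u, dist_sum p (spatial (f u')) <= dist_sum p x) ->
  dot (dist_sum_covector p x) ('D_w f u) = 0 /\
  (enorm (x - p ord0))^-1 * (dot v v - dot (direction (p ord0) x) v ^+ 2) +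
  (enorm (x - p ord_max))^-1 * (dot v v - dot (direction (p ord_max) x) v ^+ 2) +
  dot (dist_sum_covector p x) ('D_w ('D_w f) u) <= 0.
Proof.
move=> df d2f pf fmax.
pose line (t : R) := t *: w + u.
have line0 : line 0 = u by rewrite /line scale0r add0r.
have lineP (P : 'rV[R]_d -> Prop) :
    (\forall u' \near u, P u') -> \forall t \near (0 : R), P (line t).
  move=> Pu; have : {for 0, continuous line}.
    apply: differentiable_continuous; apply/derivable1_diffP.
    by have [] := (is_derive_lineP id u w w).1 (is_derive_id u w).
  by apply; rewrite line0.
have curve (t : R) i : differentiable f (line t) ->
    is_derive t 1 (fun s => spatial (f (line s)) - p i) (spatial ('D_w f (line t))).
  move=> dft; apply: is_deriveBcst; apply: is_derive_spatial.
  exact: is_derive_comp_line.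
have velocity : is_derive (0 : R) 1 (fun s => spatial ('D_w f (line s)))
    (spatial ('D_w ('D_w f) u)).
  apply: is_derive_spatial; rewrite -line0; apply: is_derive_comp_line.
  by rewrite -/(line 0) line0.
pose F t := dist_sum p (spatial (f (line t))).
pose dF t := dot (spatial (f (line t)) - p ord0) (spatial ('D_w f (line t)))
     / enorm (spatial (f (line t)) - p ord0)
   + dot (spatial (f (line t)) - p ord_max) (spatial ('D_w f (line t)))
     / enorm (spatial (f (line t)) - p ord_max).
have px i : x - p i != 0.
  by rewrite subr_eq0; apply/eqP; exact: (nbhs_singleton pf i).
have FdF : \forall t \near (0 : R), is_derive (t : R) 1 F (dF t).
  have := lineP _ df; have := lineP _ pf; apply: filterS2 => t pt dft.
  have pi0 i : spatial (f (line t)) - p i != 0 by rewrite subr_eq0; apply/eqP/pt.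
  exact: is_deriveD (is_derive_enorm (curve t ord0 dft) (pi0 _))
    (is_derive_enorm (curve t ord_max dft) (pi0 _)).
have df0 : differentiable f (line 0) by rewrite line0; exact: nbhs_singleton df.
have px0 i : spatial (f (line 0)) - p i != 0 by rewrite line0.
have dFd2 := is_deriveD
  (is_derive_dot_over_enorm (curve 0 ord0 df0) velocity (px0 ord0))
  (is_derive_dot_over_enorm (curve 0 ord_max df0) velocity (px0 ord_max)).
have Fmax : \forall t \near (0 : R), F t <= F 0.
  by have := lineP _ fmax; rewrite /F line0.
have [] := second_derivative_test FdF dFd2 Fmax.
rewrite /dF line0 -/x -/v => dF0 d2F; split.
  rewrite dot_dist_sum_covector dotDl !dotZl -dF0.
  by rewrite [_^-1 * _]mulrC [X in _ + X]mulrC.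
apply: le_trans d2F; rewrite dot_dist_sum_covector dotDl le_eqVlt; apply/orP; left.
by apply/eqP; rewrite addrACA.
Qed.

Theorem theorem1p1 (R : realType) (m : R) (p : 'I_2 -> 'rV[R]_3)
    (X : gibbons_hawking m p) (d : nat) (N : set X) :
  0 <= m -> injective p -> (1 <= d <= 3)%N ->
  compact_minimal_submanifold d (@gh_metric R 2 m p X) N ->
  circle_invariant N \/ N `<=` @minimal_sphere R m p X.
Proof.
move=> m0 injp; case: d => [//|d] _ [S [f [compS [[[cf smf] immf] minf] NE]]].
right; have p01 : p ord0 != p ord_max by apply/eqP => /injp.
(* The maximum needs a point; an empty source has an empty image. *)
have [S0|S0] := pselect ([set: S] !=set0); last first.
  by rewrite NE => q [s _ _]; case: S0; exists s.
pose E (s : S) := dist_sum p (gh_proj (f s)).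
have cE : continuous E.
  have cpf : continuous (@gh_proj R 2 m p X \o f).
    by move=> s; exact: (continuous_comp (cf s) (@gh_proj_continuous R 2 m p X _)).
  by move=> s; exact: (continuous_comp (cpf s) (@dist_sum_continuous R 3 p _)).
have [s _ smax] := compact_EVT_max S0 compS (continuous_subspaceT cE).
(* Over the segment F equals the distance between the centers. A maximum there bounds F by this
   distance, which holds only over the segment. *)
suff seg : segment (p ord0) (p ord_max) (gh_proj (f s)).
  rewrite NE => _ [s' _ <-]; apply: segment_dist_sum => //.
  by rewrite -(dist_sum_segment seg); apply: smax; rewrite inE.
apply: contrapT => nseg.
(* The centers lie on the segment, so a maximum off it is at a point with a trivialized chart, where
   F is smooth. *)
have proj_neq i : gh_proj (f s) <> p i.
  move=> E'; apply: nseg; rewrite E'; apply: segment_dist_sum => //.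
  case: i {E'} => -[|[|//]] i; rewrite /dist_sum.
    rewrite (_ : Ordinal i = ord0) ?subrr; last exact/val_inj.
    by rewrite [X in X + _](_ : _ = 0) ?add0r// /enorm dot0l sqrtr0.
  rewrite (_ : Ordinal i = ord_max) ?subrr; last exact/val_inj.
  rewrite [X in _ + X](_ : _ = 0) ?addr0; last by rewrite /enorm dot0l sqrtr0.
  by rewrite -opprB -scaleN1r enormZ normrN normr1 mul1r.
have [c' [ac' tc' c'q]] := trivialization_chart proj_neq.
have [c ac cs] := atlas_cover s.
have [_ cmapK _ _ _] := atlas_chart ac.
have [_ cmapK' _ _ _] := atlas_chart ac'.
set u := cmap c s; have [cu su] := cmapK s cs.
have Au : coord_dom f c c' u by split; rewrite // su.
have nA : nbhs u (coord_dom f c c') by exact: nbhs_coord_dom.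
set h := Defs.coord f c c'.
have projh u' : coord_dom f c c' u' ->
    ccod c' (h u') /\ gh_proj (f (cinv c u')) = spatial (h u').
  move=> [cu' /cmapK'[c'h hK]]; split=> //.
  by rewrite -(tc' _ c'h).1 /h /Defs.coord hK.
have [c'h xE] := projh u Au; rewrite su in xE.
have [_ px] := tc' _ c'h.
have dh : \forall u' \near u, differentiable h u'.
  by apply: filterS nA => u' Au'; exact: (smf c c' ac ac' [::] u' Au').
have d2h v : differentiable ('D_v h) u by exact: (smf c c' ac ac' [:: v] u Au).
have ph : \forall u' \near u, punctured_space p (spatial (h u')).
  by apply: filterS nA => u' /projh[c'hu' _]; exact: (tc' _ c'hu').2.
have hmax : \forall u' \near u,
    dist_sum p (spatial (h u')) <= dist_sum p (spatial (h u)).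
  apply: filterS nA => u' /projh[_ <-]; rewrite -xE.
  by apply: smax; rewrite inE.
have crit w := dist_sum_second_derivative dh (d2h w) ph hmax.
have [_ symg posg _] := @gh_metricP R 2 m p X.
have imm_h v : 'D_v h u = 0 -> v = 0 by exact: immf.
have [w w0] := mean_curvature0_direction dh d2h (symg _ _ ac' c'h)
  (fun v => posg _ _ v ac' c'h) imm_h (fun v => (crit v).1) (minf c c' u ac ac' Au).
have hw0 : 'D_w h u != 0 by apply: contraNneq w0 => /imm_h ->.
have ab0 : direction (p ord0) (spatial (h u)) +
    direction (p ord_max) (spatial (h u)) != 0.
  apply/eqP => ab0; apply: nseg; rewrite xE.
  by apply: segment_direction ab0; rewrite -xE; apply/eqP; exact: proj_neq.
(* Let A be dF on ['D_w ('D_w h) u], G the Christoffel term and H the Euclidean Hessian. The maximum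
   gives H + A <= 0, minimality gives 0 <= A + G, and positivity gives G < H, a contradiction. *)
have := gh_hessian_gt0 m0 ac' tc' c'h ab0 hw0.
have := (crit w).2.
rewrite -/h; lra.
Qed.
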